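(* Let $(T_1,T_2)$ be a commuting contractive pair on $\mathcal H$, $T=T_1T_2$, and let $(\mathcal F_*,\Lambda_*,P_*,U_* )$ be a Douglas-minimal Type I And\^o tuple for $(T_1^*,T_2^* )$. Define $$\boldsymbol{\mathcal K}_D=\begin{bmatrix}H^2(\mathcal F_* )\\ \mathcal Q_{T^*}\end{bmatrix},\quad \boldsymbol\Pi_D=\begin{bmatrix}(I_{H^2}\otimes\Lambda_* )\mathcal O_{D_{T^*},T^*}\\ Q_{T^*}\end{bmatrix}:\mathcal H\to\boldsymbol{\mathcal K}_D,$$ $$(\mathbf V_{D,1},\mathbf V_{D,2})=\left(\begin{bmatrix}M_{U_*^*(P_*^\perp+zP_* )}&0\\0&W_{\flat1}\end{bmatrix},\begin{bmatrix}M_{(P_*+zP_*^\perp)U_*}&0\\0&W_{\flat2}\end{bmatrix}\right)\text{ on }\boldsymbol{\mathcal K}_D.$$ Then $(\boldsymbol\Pi_D,\mathbf V_{D,1},\mathbf V_{D,2})$ is a minimal And\^o lift of $(T_1,T_2)$. Conversely, given any minimal And\^o lift $(\boldsymbol\Pi,\mathbf V_1,\mathbf V_2)$ of $(T_1,T_2)$, there is a Douglas-minimal Type I And\^o tuple $(\mathcal F_*,\Lambda_*,P_*,U_* )$ for $(T_1^*,T_2^* )$ such that $(\boldsymbol\Pi,\mathbf V_1,\mathbf V_2)$ is unitarily equivalent, as a lift, to the lift $$\left(\begin{bmatrix}(I_{H^2}\otimes\Lambda_* )\mathcal O_{D_{T^*},T^*}\\ Q_{T^*}\end{bmatrix},\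 \begin{bmatrix}M_{U_*^*(P_*^\perp+zP_* )}&0\\0&W_{\flat1}\end{bmatrix},\ \begin{bmatrix}M_{(P_*+zP_*^\perp)U_*}&0\\0&W_{\flat2}\end{bmatrix}\right)\ \text{ on }\ \begin{bmatrix}H^2(\mathcal F_* )\\ \mathcal Q_{T^*}\end{bmatrix}$$ constructed from this tuple.
   Context: Commuting contractive pair: commuting operators of norm at most $1$. For a contraction $T$: $D_{T^*}=(I-TT^* )^{1/2}$, $\mathcal D_{T^*}=\overline{\operatorname{Ran}}\,D_{T^*}$. $H^2(\mathcal F)$ is the $\mathcal F$-valued Hardy space of the unit disk; $M_{A+zB}$ is multiplication by $A+zB$ for $A,B\in\mathcal B(\mathcal F)$; $I_{H^2}\otimes\Lambda$ is $f(z)\mapsto\Lambda f(z)$; $P^\perp=I-P$. And\^o lift of $(T_1,T_2)$: $(\Pi,V_1,V_2)$ with $\Pi:\mathcal H\to\mathcal K$ isometric and $(V_1,V_2)$ commuting isometries on $\mathcal K$ with $V_j^*\Pi=\Pi T_j^*$. Minimal: $\mathcal K=\bigvee_{n_1,n_2\ge0}V_1^{n_1}V_2^{n_2}\operatorname{Ran}\Pi$. Two lifts are unitarily equivalent if there is a unitary $\tau:\mathcal K\to\mathcal K'$ with $\tau\Pi=\Pi'$, $\tau V_j=V_j'\tau$. A Type I And\^o tuple for $(T_1^*,T_2^* )$ is $(\mathcal F_*,\Lambda_*,P_*,U_* )$ with $\mathcal F_*$ a Hilbert space, $\Lambda_*:\mathcal D_{T^*}\to\mathcal F_*$ an isometry,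 $P_*$ an orthogonal projection and $U_*$ a unitary on $\mathcal F_*$, such that $$P_*^\perp U_*\Lambda_*D_{T^*}+P_*U_*\Lambda_*D_{T^*}T^*=\Lambda_*D_{T^*}T_1^*,\quad U_*^*P_*\Lambda_*D_{T^*}+U_*^*P_*^\perp\Lambda_*D_{T^*}T^*=\Lambda_*D_{T^*}T_2^*.$$ It is Douglas-minimal if the smallest closed subspace of $H^2(\mathcal F_* )$ invariant for $M_{U_*^*(P_*^\perp+zP_* )}$ and $M_{(P_*+zP_*^\perp)U_*}$ and containing $H^2(\operatorname{Ran}\Lambda_* )$ is $H^2(\mathcal F_* )$. $Q_{T^*}$ is the positive square root of $\operatorname{SOT-}\lim_nT^nT^{*n}$; $X^*Q_{T^*}h=Q_{T^*}T^*h$ defines an isometry $X^*$ on $\overline{\operatorname{Ran}}\,Q_{T^*}$, and $W_D^*$ on $\mathcal Q_{T^*}\supset\overline{\operatorname{Ran}}\,Q_{T^*}$ is its minimal unitary extension. $W_{\flat1},W_{\flat2}$ is the unique pair of commuting unitaries on $\mathcal Q_{T^*}$ with $W_{\flat1}W_{\flat2}=W_D$ and $W_{\flat j}^*Q_{T^*}=Q_{T^*}T_j^*$. $\mathcal O_{D_{T^*},T^*}:\mathcal H\to H^2(\mathcal D_{T^*})$ is $h\mapsto\sum_{n\ge0}z^nD_{T^*}T^{*n}h$. *)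

(* Defs.v *)
From HB Require Import structures.
From mathcomp Require Import all_boot all_order all_algebra.
From mathcomp Require Import complex ring.
From mathcomp Require Import boolp classical_sets functions reals topology
  normedtype sequences.

Set Implicit Arguments.
Unset Strict Implicit.
Unset Printing Implicit Defensive.

Import Order.TTheory GRing.Theory Num.Theory.
Import numFieldNormedType.Exports.

Local Open Scope ring_scope.
Local Open Scope classical_set_scope.

HB.mixin Record CompleteNormedModule_isHilbert (R : realType) V
    & CompleteNormedModule R[i] V := {
  hdot : V -> V -> R[i];
  hdot_linearl : forall a x y z, hdot (a *: x + y) z = a * hdot x z + hdot y z;
  hdot_conj : forall x y, hdot x y = (hdot y x)^*;
  hdot_norm : forall x, hdot x x = `|x| ^+ 2
}.

#[short(type="hilbertType")]
HB.structure Definition Hilbert (R : realType) :=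
  { V of CompleteNormedModule R[i] V & CompleteNormedModule_isHilbert R V }.

Section PreHilbert.
Variables (C : numClosedFieldType) (V : lmodType C) (dot : V -> V -> C).
Hypothesis dot_lin : forall a x y z,
  dot (a *: x + y) z = a * dot x z + dot y z.
Hypothesis dot_conj : forall x y, dot x y = (dot y x)^*.
Hypothesis dot_ge0 : forall x, 0 <= dot x x.
Hypothesis dot_eq0 : forall x, dot x x = 0 -> x = 0.

Lemma pre_dotDl x y z : dot (x + y) z = dot x z + dot y z.
Proof. by have := dot_lin 1 x y z; rewrite scale1r mul1r. Qed.

Lemma pre_dot0l z : dot 0 z = 0.
Proof.
have := dot_lin 1 0 0 z; rewrite scale1r mul1r addr0 => /eqP.
by rewrite addrC -subr_eq subrr => /eqP.
Qed.

Lemma pre_dotZl a x z : dot (a *: x) z = a * dot x z.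
Proof. by have := dot_lin a x 0 z; rewrite addr0 pre_dot0l addr0. Qed.

Lemma pre_dotDr x y z : dot z (x + y) = dot z x + dot z y.
Proof. by rewrite dot_conj pre_dotDl rmorphD /= -!dot_conj. Qed.

Lemma pre_dotZr a x z : dot z (a *: x) = a^* * dot z x.
Proof. by rewrite dot_conj pre_dotZl rmorphM /= -!dot_conj. Qed.

Lemma pre_CauchySchwarz x y : `|dot x y| ^+ 2 <= dot x x * dot y y.
Proof.
have [y0|y0] := eqVneq (dot y y) 0.
  have x0 : dot x 0 = 0 by rewrite dot_conj pre_dot0l rmorph0.
  by rewrite (dot_eq0 y0) x0 pre_dot0l normr0 expr0n mulr0.
have yp : 0 < dot y y by rewrite lt_def y0 dot_ge0.
pose a := dot x y / dot y y.
have := dot_ge0 (x + (- a) *: y).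
have yr : (dot y y)^* = dot y y by rewrite -dot_conj.
have aE : a * dot y y = dot x y by rewrite /a divfK.
have aE' : a^* * dot y y = dot y x by rewrite -{1}yr -rmorphM /= aE -dot_conj.
rewrite pre_dotDl !pre_dotDr !pre_dotZl !pre_dotZr !rmorphN /= !mulNr.
rewrite aE' mulrN opprK addNr addr0 => h.
have {h} : 0 <= dot y y * (dot x x - a^* * dot x y) by rewrite mulr_ge0 // ltW.
rewrite mulrBr subr_ge0 => h.
rewrite mulrC; apply: le_trans h.
by rewrite normCK -dot_conj mulrA [dot y y * _]mulrC aE' mulrC.
Qed.

Lemma pre_triangle x y :
  sqrtC (dot (x + y) (x + y)) <= sqrtC (dot x x) + sqrtC (dot y y).
Proof.
have h0 z : 0 <= sqrtC (dot z z) by rewrite sqrtC_ge0.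
rewrite -ler_sqr ?nnegrE ?addr_ge0// sqrtCK sqrrD !sqrtCK.
have h : dot x y + dot y x <= (sqrtC (dot x x) * sqrtC (dot y y)) *+ 2.
  have : 'Re (dot x y) <= sqrtC (dot x x) * sqrtC (dot y y).
    apply: (le_trans (leif_Re_Creal _)).
    rewrite -ler_sqr ?nnegrE ?mulr_ge0// exprMn !sqrtCK.
    exact: pre_CauchySchwarz.
  by rewrite ReE ler_pdivrMr ?ltr0n// mulr_natr -dot_conj.
rewrite pre_dotDl !pre_dotDr.
have -> : dot x x + dot x y + (dot y x + dot y y) =
  dot x x + (dot x y + dot y x) + dot y y by rewrite !addrA.
by rewrite lerD2r lerD2l.
Qed.

End PreHilbert.

Lemma complex_archi (R : realType) (e : R[i]) :
  0 < e -> exists N : nat, N.+1%:R^-1 < e.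
Proof.
case: e => a b; rewrite ltcE /= => /andP[/eqP b0 a0]; rewrite b0.
have [k] := ltr_add_invr a0; rewrite add0r => kE; exists k.
by rewrite -(rmorph_nat (real_complex R)) -fmorphV /= ltcR.
Qed.

HB.factory Record Lmodule_isHilbert (R : realType) V & GRing.Lmodule R[i] V := {
  dot : V -> V -> R[i];
  dot_linear : forall a x y z, dot (a *: x + y) z = a * dot x z + dot y z;
  dot_conj : forall x y, dot x y = (dot y x)^*;
  dot_ge0 : forall x, 0 <= dot x x;
  dot_eq0 : forall x, dot x x = 0 -> x = 0;
  dot_complete : forall u : nat -> V,
    (forall e : R[i], 0 < e -> exists N, forall m n, (N <= m)%N -> (N <= n)%N ->
       dot (u m - u n) (u m - u n) <= e) ->
    exists l, forall e : R[i], 0 < e -> exists N, forall n, (N <= n)%N ->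
       dot (u n - l) (u n - l) <= e
}.

HB.builders Context R V & Lmodule_isHilbert R V.

Let nm (x : V) := sqrtC (dot x x).

Let nm_triangle x y : nm (x + y) <= nm x + nm y.
Proof. exact: (pre_triangle dot_linear dot_conj dot_ge0 dot_eq0). Qed.

Let nmZ (a : R[i]) x : nm (a *: x) = `|a| * nm x.
Proof.
rewrite /nm (pre_dotZl dot_linear) (pre_dotZr dot_linear dot_conj) mulrA -normCK.
by rewrite sqrtCM ?nnegrE ?exprn_ge0 ?dot_ge0// sqrCK.
Qed.

Let nm_eq0 x : nm x = 0 -> x = 0.
Proof. by move=> /eqP; rewrite sqrtC_eq0 => /eqP; exact: dot_eq0. Qed.

HB.instance Definition _ := Lmodule_isNormed.Build R[i] V nm_triangle nmZ nm_eq0.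

Let dotE x : dot x x = `|x| ^+ 2.
Proof. by rewrite -[`|x|]/(nm x) /nm sqrtCK. Qed.

Let V_complete (F : set_system V) : ProperFilter F -> cauchy F -> cvg F.
Proof.
move=> FF /cauchyP Fc.
have d0 (n : nat) : 0 < (n.+1%:R^-1 : R[i]) by rewrite invr_gt0 ltr0n.
have /choice[u uP] : forall n : nat, exists x, F (ball x (n.+1%:R^-1 : R[i])).
  by move=> n; exact: (Fc _ (d0 n)).
have le_d m n : (n <= m)%N -> (m.+1%:R^-1 : R[i]) <= n.+1%:R^-1.
  by move=> nm'; rewrite lef_pV2 ?posrE ?ltr0n// ler_nat.
have [|l lP] := @dot_complete u.
  move=> e e0; have e20 : 0 < sqrtC e / 2 by rewrite divr_gt0 ?sqrtC_gt0.
  have [N Ne] := complex_archi e20; exists N => m n Nm Nn.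
  rewrite dotE -[e]sqrtCK.
  rewrite ler_sqr ?nnegrE ?normr_ge0 ?sqrtC_ge0 ?(ltW e0)//.
  have /filter_ex [z []] : F (ball (u m) m.+1%:R^-1 `&` ball (u n) n.+1%:R^-1).
    exact: filterI.
  rewrite -!ball_normE /= => zm zn.
  rewrite -(subrKA z) (le_trans (ler_normD _ _))// (splitr (sqrtC e)) lerD//.
    by rewrite (le_trans (ltW zm))// (le_trans (le_d _ _ Nm))// ltW.
  by rewrite distrC (le_trans (ltW zn))// (le_trans (le_d _ _ Nn))// ltW.
apply: (@cvgP _ _ l); apply/cvgrPdist_le => e e0.
have e20 : 0 < e / 2 by rewrite divr_gt0.
have [N1 N1e] := complex_archi e20.
have [|N2 N2e] := lP ((e / 2) ^+ 2); first by rewrite exprn_gt0.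
pose N := maxn N1 N2.
apply: filterS (uP N) => x; rewrite -ball_normE /= => xN.
rewrite -(subrKA (u N)) (le_trans (ler_normD _ _))// (splitr e) lerD//.
  rewrite distrC -ler_sqr ?nnegrE// ?(ltW e20)// -dotE.
  by apply: N2e; exact: leq_maxr.
by rewrite (le_trans (ltW xN))// (le_trans (le_d _ _ (leq_maxl _ _)))// ltW.
Qed.

HB.instance Definition _ := Uniform_isComplete.Build V V_complete.
HB.instance Definition _ := CompleteNormedModule_isHilbert.Build R V
  dot_linear dot_conj dotE.

HB.end.

Section HilbertTheory.
Variables (R : realType) (V : hilbertType R).
Implicit Types (x y z : V) (a : R[i]).

Lemma hdot_ge0 x : 0 <= hdot x x.
Proof. by rewrite hdot_norm exprn_ge0. Qed.

Lemma hdot_eq0 x : hdot x x = 0 -> x = 0.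
Proof. by rewrite hdot_norm => /eqP; rewrite sqrf_eq0 normr_eq0 => /eqP. Qed.

Lemma hdotDl x y z : hdot (x + y) z = hdot x z + hdot y z.
Proof. exact: (pre_dotDl (@hdot_linearl R V)). Qed.

Lemma hdotZl a x z : hdot (a *: x) z = a * hdot x z.
Proof. exact: (pre_dotZl (@hdot_linearl R V)). Qed.

Lemma hdotDr x y z : hdot z (x + y) = hdot z x + hdot z y.
Proof. exact: (pre_dotDr (@hdot_linearl R V) (@hdot_conj R V)). Qed.

Lemma hdotZr a x z : hdot z (a *: x) = a^* * hdot z x.
Proof. exact: (pre_dotZr (@hdot_linearl R V) (@hdot_conj R V)). Qed.

Lemma CauchySchwarz_hdot x y : `|hdot x y| <= `|x| * `|y|.
Proof.
rewrite -ler_sqr ?nnegrE ?mulr_ge0// exprMn -!hdot_norm.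
exact: (pre_CauchySchwarz (@hdot_linearl R V) (@hdot_conj R V) hdot_ge0 hdot_eq0).
Qed.

Lemma hilbert_complete (u : nat -> V) :
  (forall e : R[i], 0 < e -> exists N, forall m n, (N <= m)%N -> (N <= n)%N ->
    hdot (u m - u n) (u m - u n) <= e) ->
  cvgn u.
Proof.
move=> uc; apply/cauchy_cvgP/cauchy_exP => e e0.
have e20 : 0 < (e / 2) ^+ 2 by rewrite exprn_gt0 ?divr_gt0.
have [N Ne] := uc _ e20; exists (u N), N => // n /= Nn.
rewrite -ball_normE /=; apply: (@le_lt_trans _ _ (e / 2)); last first.
  by rewrite ltr_pdivrMr// ltr_pMr// ltr1n.
rewrite -ler_sqr ?nnegrE ?(ltW (divr_gt0 _ _))// -hdot_norm.
by apply: Ne.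
Qed.

Definition closed_subspace (S : set V) : Prop :=
  [/\ S 0, forall a x y, S x -> S y -> S (a *: x + y) & closed S].

Lemma closureNP (A : set V) x :
  closure A x <-> forall e : R[i], 0 < e -> exists2 y, A y & `|x - y| < e.
Proof.
split=> [Ax e e0|Ax B /nbhs_ballP[e /= e0 eB]].
  have [|y [Ay]] := Ax (ball x e); first exact: nbhsx_ballx.
  by rewrite -ball_normE /= => xy; exists y.
have [y Ay xy] := Ax e e0; exists y; split=> //.
by apply: eB; rewrite -ball_normE.
Qed.

Lemma closure_subspace (S : set V) : S 0 ->
  (forall a x y, S x -> S y -> S (a *: x + y)) -> closed_subspace (closure S).
Proof.
move=> S0 Sl; split; [exact: subset_closure| |exact: closed_closure].
move=> a x y /closureNP Sx /closureNP Sy; apply/closureNP => e e0.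
have d0 : 0 < 2 * (1 + `|a|) by rewrite mulr_gt0// ltr_wpDr.
have [x' Sx' xx'] := Sx (e / (2 * (1 + `|a|))) (divr_gt0 e0 d0).
have e20 : 0 < e / 2 by rewrite divr_gt0.
have [y' Sy' yy'] := Sy _ e20.
exists (a *: x' + y'); first exact: Sl.
rewrite opprD addrACA -scalerBr (le_lt_trans (ler_normD _ _))// normrZ.
rewrite (splitr e) ler_ltD//.
have h1 : 0 < 1 + `|a| by rewrite ltr_wpDr.
apply: (@le_trans _ _ ((1 + `|a|) * (e / (2 * (1 + `|a|))))).
  by rewrite ler_pM// ?lerDr// ltW.
by rewrite mulrCA invfM [2^-1 * _]mulrC mulVKf ?gt_eqF.
Qed.

End HilbertTheory.

(* Hilbert-space direct sum; an alias is needed because the normed module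
   structure of the library on E * F is that of the sup norm. *)
Definition hsum (R : realType) (E F : hilbertType R) : Type := (E * F)%type.

Section Hsum.
Variables (R : realType) (E F : hilbertType R).
HB.instance Definition _ := GRing.Lmodule.copy (hsum E F) (E * F)%type.

Let dot (x y : hsum E F) : R[i] := hdot x.1 y.1 + hdot x.2 y.2.

Let dot_linear a x y z : dot (a *: x + y) z = a * dot x z + dot y z.
Proof. by rewrite /dot /= !hdot_linearl mulrDr addrACA. Qed.

Let dot_conj x y : dot x y = (dot y x)^*.
Proof. by rewrite /dot rmorphD /= -!hdot_conj. Qed.

Let dot_ge0 x : 0 <= dot x x.
Proof. by rewrite addr_ge0 ?hdot_ge0. Qed.

Let dot_eq0 x : dot x x = 0 -> x = 0.
Proof.
case: x => x y /eqP; rewrite paddr_eq0 ?hdot_ge0// => /andP[/eqP /= x0 /eqP y0].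
by rewrite (hdot_eq0 x0) (hdot_eq0 y0).
Qed.

Let dot_complete (u : nat -> hsum E F) :
  (forall e : R[i], 0 < e -> exists N, forall m n, (N <= m)%N -> (N <= n)%N ->
     dot (u m - u n) (u m - u n) <= e) ->
  exists l, forall e : R[i], 0 < e -> exists N, forall n, (N <= n)%N ->
     dot (u n - l) (u n - l) <= e.
Proof.
move=> uc.
have c1 : cvgn (fun n => (u n).1).
  apply: hilbert_complete => e e0; have [N Ne] := uc e e0.
  exists N => m n Nm Nn; apply: le_trans (Ne _ _ Nm Nn).
  by rewrite /dot /= lerDl hdot_ge0.
have c2 : cvgn (fun n => (u n).2).
  apply: hilbert_complete => e e0; have [N Ne] := uc e e0.
  exists N => m n Nm Nn; apply: le_trans (Ne _ _ Nm Nn).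
  by rewrite /dot /= lerDr hdot_ge0.
exists (limn (fun n => (u n).1), limn (fun n => (u n).2)) => e e0.
have h0 : 0 < sqrtC (e / 2) by rewrite sqrtC_gt0 divr_gt0.
have /cvgrPdist_le /(_ _ h0) [N1 _ N1e] := c1.
have /cvgrPdist_le /(_ _ h0) [N2 _ N2e] := c2.
exists (maxn N1 N2) => n; rewrite geq_max => /andP[n1 n2].
have hh (W : hilbertType R) (x y : W) :
    `|x - y| <= sqrtC (e / 2) -> hdot (y - x) (y - x) <= e / 2.
  move=> xy; rewrite hdot_norm distrC -[leRHS]sqrtCK ler_sqr ?nnegrE//.
  exact: ltW.
rewrite (splitr e) /dot /= lerD//; apply: hh; [exact: N1e|exact: N2e].
Qed.

HB.instance Definition _ := Lmodule_isHilbert.Build R (hsum E F)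
  dot_linear dot_conj dot_ge0 dot_eq0 dot_complete.

End Hsum.

Record csubspace (R : realType) (V : hilbertType R) := CSubspace {
  csub_set :> set V;
  csubP : closed_subspace csub_set
}.

Record csub (R : realType) (V : hilbertType R) (S : csubspace V) :=
  CSub { csub_val :> V; csub_mem : csub_val \in csub_set S }.

Section Csub.
Variables (R : realType) (V : hilbertType R) (S : csubspace V).

HB.instance Definition _ := [isSub for @csub_val R V S].
HB.instance Definition _ := [Choice of csub S by <:].

Let pred_submod : submod_closed [in csub_set S].
Proof.
have [S0 Sl _] := csubP S; split; first by rewrite inE.
by move=> a x y; rewrite !inE; exact: Sl.
Qed.
HB.instance Definition _ :=
  GRing.SubChoice_isSubLmodule.Build R[i] V [in csub_set S] (csub S) pred_submod.

Let dot (x y : csub S) : R[i] := hdot (val x) (val y).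

Let dot_linear a x y z : dot (a *: x + y) z = a * dot x z + dot y z.
Proof. by rewrite /dot linearP hdot_linearl. Qed.

Let dot_conj x y : dot x y = (dot y x)^*.
Proof. exact: hdot_conj. Qed.

Let dot_ge0 x : 0 <= dot x x.
Proof. exact: hdot_ge0. Qed.

Let dot_eq0 x : dot x x = 0 -> x = 0.
Proof. by move=> /hdot_eq0 x0; apply: val_inj; rewrite x0 linear0. Qed.

Let dot_complete (u : nat -> csub S) :
  (forall e : R[i], 0 < e -> exists N, forall m n, (N <= m)%N -> (N <= n)%N ->
     dot (u m - u n) (u m - u n) <= e) ->
  exists l, forall e : R[i], 0 < e -> exists N, forall n, (N <= n)%N ->
     dot (u n - l) (u n - l) <= e.
Proof.
move=> uc.
have c : cvgn (fun n => val (u n)).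
  apply: hilbert_complete => e e0; have [N Ne] := uc e e0.
  by exists N => m n Nm Nn; have := Ne _ _ Nm Nn; rewrite /dot linearB.
have [_ _ Sc] := csubP S.
have Sl : limn (fun n => val (u n)) \in csub_set S.
  rewrite inE; apply: (closed_cvg _ Sc _ _ c).
  by apply: nearW => n; have := csub_mem (u n); rewrite inE.
exists (CSub Sl) => e e0.
have h0 : 0 < sqrtC e by rewrite sqrtC_gt0.
have /cvgrPdist_le /(_ _ h0) [N _ Ne] := c.
exists N => n Nn; have := Ne n Nn; rewrite /= distrC => xy.
rewrite /dot linearB /= hdot_norm -[leRHS]sqrtCK ler_sqr ?nnegrE//.
exact: ltW.
Qed.

HB.instance Definition _ := Lmodule_isHilbert.Build R (csub S)
  dot_linear dot_conj dot_ge0 dot_eq0 dot_complete.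

End Csub.

Section ComplexSeries.
Variable R : realType.
Notation C := (R[i]^o).
Implicit Types (u v : nat -> C) (l M : C).

Lemma complex_lim_ge0 u l : (forall n, 0 <= u n) -> u @ \oo --> l -> 0 <= l.
Proof.
move=> u0 ul; suff -> : l = `|l| by [].
apply: (@norm_cvg_unique _ C _ _ _ _ ul).
have -> : u = fun n => `|u n| by apply/funext => n; rewrite ger0_norm.
exact: (@cvg_norm _ C _ _ _ _ _ ul).
Qed.

Lemma complex_lim_le u l M : (forall n, u n <= M) -> u @ \oo --> l -> l <= M.
Proof.
move=> uM ul; rewrite -subr_ge0.
apply: (@complex_lim_ge0 (fun n => M - u n)); first by move=> n; rewrite subr_ge0.
by apply: (@cvgB _ C); [exact: cvg_cst|exact: ul].
Qed.

Lemma complex_lim_conj u l :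
  u @ \oo --> l -> (fun n => (u n)^* : C) @ \oo --> (l^* : C).
Proof.
move=> /cvgrPdist_le ul; apply/cvgrPdist_le => e e0.
by apply: filterS (ul e e0) => n /=; rewrite -rmorphB /= norm_conjC.
Qed.

Lemma ge0_series_cvg u M : (forall n, 0 <= u n) -> (forall n, series u n <= M) ->
  cvgn (series u).
Proof.
move=> u0 uM.
pose v n := complex.Re (series u n).
have vE n : series u n = (v n)%:C%C.
  by rewrite /v RRe_real// ger0_real// /series /= sumr_ge0.
have vmono : {homo v : n m / (n <= m)%N >-> n <= m}.
  move=> n m nm; rewrite -lecR -!vE -subr_ge0 sub_series_geq//.
  exact: sumr_ge0.
have vb : has_ubound (range v).
  exists (complex.Re M) => _ [n _ <-].
  by have := uM n; rewrite vE lecE => /andP[].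
have /cvgrPdist_le vc := nondecreasing_is_cvgn vmono vb.
apply: (@cvgP _ _ ((limn v)%:C%C : C)); apply/cvgrPdist_le => -[e e'].
rewrite ltcE /= => /andP[/eqP -> e0].
apply: filterS (vc e e0) => n /= h.
rewrite vE -rmorphB /= normc_def /= expr0n /= addr0 sqrtr_sqr lecR.
exact: h.
Qed.

Lemma series_le_lim u n : (forall n, 0 <= u n) -> cvgn (series u) ->
  series u n <= limn (series u).
Proof.
move=> u0 uc; rewrite -subr_ge0.
apply: (@complex_lim_ge0 (fun k => series u (k + n)%N - series u n)).
  by move=> k; rewrite sub_series_geq ?leq_addl//; exact: sumr_ge0.
apply: (@cvgB _ C); last exact: cvg_cst.
by have := uc; rewrite -(cvg_shiftn n).
Qed.

End ComplexSeries.

Section SquareSummable.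
Variables (R : realType) (F : hilbertType R).
Notation C := (R[i]^o).

Definition square_summable (a : nat -> F) : Prop :=
  cvgn (series (fun n => `|a n| ^+ 2 : C)).

Lemma square_summableP (a : nat -> F) :
  square_summable a <->
  exists M : R[i], forall n, \sum_(0 <= k < n) `|a k| ^+ 2 <= M.
Proof.
have a0 n : 0 <= (`|a n| ^+ 2 : C) by rewrite exprn_ge0.
split=> [ac|[M aM]]; last exact: (ge0_series_cvg a0 aM).
by exists (limn (series (fun n => `|a n| ^+ 2 : C))) => n; exact: series_le_lim.
Qed.

Lemma le_sqr_normD (x y : F) : `|x + y| ^+ 2 <= 2 * `|x| ^+ 2 + 2 * `|y| ^+ 2.
Proof.
have := exprn_ge0 2 (normr_ge0 (x - y)).
rewrite -!hdot_norm -scaleN1r !hdotDl !hdotDr !hdotZl !hdotZr rmorphN rmorph1 /=.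
rewrite !mulN1r opprK => h.
rewrite -subr_ge0; apply: le_trans h _; rewrite le_eqVlt; apply/orP; left.
apply/eqP; set a := hdot x x; set b := hdot x y.
set c := hdot y x; set d := hdot y y.
by ring.
Qed.

Lemma square_summable_linear (c : R[i]) (a b : nat -> F) :
  square_summable a -> square_summable b -> square_summable (c *: a + b).
Proof.
move=> /square_summableP[M aM] /square_summableP[N bN]; apply/square_summableP.
exists (2 * (`|c| ^+ 2 * M) + 2 * N) => n.
apply: (@le_trans _ _ (2 * (`|c| ^+ 2 * \sum_(0 <= k < n) `|a k| ^+ 2)
                       + 2 * \sum_(0 <= k < n) `|b k| ^+ 2)).
  rewrite !mulr_sumr -big_split /=; apply: ler_sum => k _.
  by rewrite -exprMn -normrZ; exact: le_sqr_normD.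
by rewrite lerD// ler_wpM2l// ler_wpM2l// exprn_ge0.
Qed.

Lemma square_summable0 : square_summable (0 : nat -> F).
Proof.
apply/square_summableP; exists 0 => n.
by rewrite big1// => k _; rewrite normr0 expr0n.
Qed.

End SquareSummable.

Lemma series_linear_cvg (R : realType) (a : R[i]) (u v : nat -> R[i]^o)
    (l m : R[i]^o) :
  series u @ \oo --> l -> series v @ \oo --> m ->
  series (fun n => a * u n + v n : R[i]^o) @ \oo --> (a * l + m : R[i]^o).
Proof.
move=> ul vm.
have -> : series (fun n => a * u n + v n : R[i]^o) =
    (fun n => a * series u n + series v n : R[i]^o).
  by apply/funext => n; rewrite /series /= big_split /= -mulr_sumr.
apply: (@cvgD _ R[i]^o _ _ _ _ _ _ _ _ vm).
exact: (@cvgMl_tmp R[i] _ _ _ _ a _ ul).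
Qed.

Lemma polarization (R : realType) (F : hilbertType R) (x y : F) :
  hdot x y = 2^-1 * (`|x + y| ^+ 2) + ('i / 2 * (`|x + 'i *: y| ^+ 2)
     + (- (1 + 'i) / 2 * (`|x| ^+ 2) + (- (1 + 'i) / 2 * (`|y| ^+ 2) + 0))).
Proof.
rewrite -!hdot_norm !hdotDl !hdotDr !hdotZl !hdotZr conjCi.
set a := hdot x x; set b := hdot x y; set c := hdot y x; set d := hdot y y.
have i2 : ('i * 'i : R[i]) = -1 by rewrite -expr2 sqrCi.
set i := 'i in i2 *.
have h2 : (2^-1 : R[i]) + 2^-1 = 1.
  by have := splitr (1 : R[i]); rewrite mul1r => <-.
set h := 2^-1 in h2 *.
by ring: i2 h2.
Qed.

Lemma hdot_series_cvg (R : realType) (F : hilbertType R) (a b : nat -> F) :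
  square_summable a -> square_summable b ->
  cvgn (series (fun n => hdot (a n) (b n) : R[i]^o)).
Proof.
move=> sa sb.
have sD c : cvgn (series (fun n => `|a n + c *: b n| ^+ 2 : R[i]^o)).
  have := square_summable_linear (c := c) sb sa.
  by rewrite /square_summable addrC.
have := sD 1; under [X in series X]funext do rewrite scale1r; move=> s1.
have -> : (fun n => hdot (a n) (b n) : R[i]^o) =
  (fun n => 2^-1 * (`|a n + b n| ^+ 2) + ('i / 2 * (`|a n + 'i *: b n| ^+ 2)
     + (- (1 + 'i) / 2 * (`|a n| ^+ 2) + (- (1 + 'i) / 2 * (`|b n| ^+ 2) + 0)))).
  by apply/funext => n; exact: polarization.
have s0 : series (fun=> 0 : R[i]^o) @ \oo --> (0 : R[i]^o).
  have -> : series (fun=> 0 : R[i]^o) = (fun=> 0 : R[i]^o).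
    by apply/funext => n; rewrite /series /= big1.
  exact: cvg_cst.
apply: cvgP; apply: series_linear_cvg; first exact: s1.
apply: series_linear_cvg; first exact: sD.
apply: series_linear_cvg; first exact: sa.
apply: series_linear_cvg; first exact: sb.
exact: s0.
Qed.

Lemma complex_cvg_sum (R : realType) K (u : nat -> nat -> R[i]^o)
    (l : nat -> R[i]^o) : (forall k, u k @ \oo --> l k) ->
  (fun n => \sum_(0 <= k < K) u k n : R[i]^o) @ \oo -->
  (\sum_(0 <= k < K) l k : R[i]^o).
Proof.
move=> ul; elim: K => [|K IH].
  rewrite big_nil.
  have -> : (fun n => \sum_(0 <= k < 0) u k n : R[i]^o) = fun=> 0.
    by apply/funext => n; rewrite big_nil.
  exact: cvg_cst.
rewrite (@big_nat_recr _ _ _ K 0 _ (leq0n K)).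
have -> : (fun n => \sum_(0 <= k < K.+1) u k n : R[i]^o) =
    fun n => (\sum_(0 <= k < K) u k n : R[i]^o) + u K n.
  by apply/funext => n; exact: (@big_nat_recr _ _ _ K 0 _ (leq0n K)).
exact (@cvgD _ R[i]^o _ _ _ _ _ _ _ IH (ul K)).
Qed.

Lemma cvg_sqr_norm (R : realType) (F : hilbertType R) (u : nat -> F) (l : F) :
  u @ \oo --> l ->
  (fun n => `|u n| ^+ 2 : R[i]^o) @ \oo --> (`|l| ^+ 2 : R[i]^o).
Proof.
move=> /cvg_norm ul.
exact (@cvgM R[i] _ _ _ _ _ _ _ ul ul).
Qed.

(* The Hardy space H^2(F) over the unit disk: the F-valued power series
   f(z) = sum_n z^n f_n with sum_n |f_n|^2 < oo, represented by their
   coefficients; [H2eval] below is the associated function on the disk, and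
   [H2eval_inj] shows that it determines the coefficients. *)
Record H2 (R : realType) (F : hilbertType R) := MkH2 {
  coef :> nat -> F;
  coef_summable : `[< square_summable coef >]
}.

Section H2Hilbert.
Variables (R : realType) (F : hilbertType R).
Notation C := (R[i]^o).

HB.instance Definition _ := [isSub for @coef R F].
HB.instance Definition _ := [Choice of H2 F by <:].

Let H2_submod : submod_closed [pred a : nat -> F | `[< square_summable a >]].
Proof.
split; first exact: (asboolT (@square_summable0 R F)).
move=> c a b sa sb.
have {}sa := asboolW (sa : `[< square_summable a >]).
have {}sb := asboolW (sb : `[< square_summable b >]).
exact: (asboolT (square_summable_linear (c := c) sa sb)).
Qed.
HB.instance Definition _ := GRing.SubChoice_isSubLmodule.Build R[i] (nat -> F)
  [pred a : nat -> F | `[< square_summable a >]] (H2 F) H2_submod.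

Lemma H2P (f : H2 F) : square_summable f.
Proof. by have /asboolP := coef_summable f. Qed.

Arguments H2P : clear implicits.

Let dot (f g : H2 F) : R[i] := limn (series (fun n => hdot (f n) (g n) : C)).

Let dot_cvg (f g : H2 F) :
  series (fun n => hdot (f n) (g n) : C) @ \oo --> (dot f g : C).
Proof. exact (hdot_series_cvg (H2P f) (H2P g)). Qed.

Let coefP a (f g : H2 F) n : (a *: f + g) n = a *: f n + g n.
Proof. by []. Qed.

Let dot_linear a x y z : dot (a *: x + y) z = a * dot x z + dot y z.
Proof.
apply: (@norm_cvg_unique _ C _ _ _ _ (@dot_cvg _ _)).
have -> : (fun n => hdot ((a *: x + y) n) (z n) : C) =
    (fun n => a * hdot (x n) (z n) + hdot (y n) (z n) : C).
  by apply/funext => n; rewrite coefP hdot_linearl.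
exact (series_linear_cvg (@dot_cvg x z) (@dot_cvg y z)).
Qed.

Let dot_conj x y : dot x y = (dot y x)^*.
Proof.
apply: (@norm_cvg_unique _ C _ _ _ _ (@dot_cvg _ _)).
have -> : series (fun n => hdot (x n) (y n) : C) =
    (fun n => (series (fun n => hdot (y n) (x n) : C) n)^* : C).
  apply/funext => n; rewrite /series /= rmorph_sum /=.
  by apply: eq_bigr => k _; rewrite -hdot_conj.
exact (complex_lim_conj (@dot_cvg y x)).
Qed.

Let dot_sum (f : H2 F) n : \sum_(0 <= k < n) `|f k| ^+ 2 <= dot f f.
Proof.
have fE : (fun n => hdot (f n) (f n) : C) = (fun n => `|f n| ^+ 2 : C).
  by apply/funext => k; rewrite hdot_norm.
rewrite /dot fE; apply: (@series_le_lim _ _ n _ (H2P f)).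
by move=> k; rewrite exprn_ge0.
Qed.

Let dot_le (f : H2 F) M :
  (forall n, \sum_(0 <= k < n) `|f k| ^+ 2 <= M) -> dot f f <= M.
Proof.
move=> fM; apply: (complex_lim_le _ (@dot_cvg f f)) => n.
apply: le_trans (fM n); rewrite /series /=.
by apply: ler_sum => k _; rewrite hdot_norm.
Qed.

Let dot_ge0 x : 0 <= dot x x.
Proof. by have := dot_sum x 0; rewrite big_nil. Qed.

Let dot_coef (f : H2 F) n : `|f n| ^+ 2 <= dot f f.
Proof.
apply: le_trans (dot_sum f n.+1); rewrite big_nat_recr //= lerDr.
by apply: sumr_ge0 => k _; rewrite exprn_ge0.
Qed.

Let dot_eq0 x : dot x x = 0 -> x = 0.
Proof.
move=> x0; apply: val_inj; apply/funext => n /=.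
have := dot_coef x n; rewrite x0 => h; apply/eqP.
by rewrite -normr_eq0 -sqrf_eq0 eq_le h exprn_ge0.
Qed.

Let dot_complete (u : nat -> H2 F) :
  (forall e : R[i], 0 < e -> exists N, forall m n, (N <= m)%N -> (N <= n)%N ->
     dot (u m - u n) (u m - u n) <= e) ->
  exists l, forall e : R[i], 0 < e -> exists N, forall n, (N <= n)%N ->
     dot (u n - l) (u n - l) <= e.
Proof.
move=> uc.
have c k : cvgn (fun n => u n k).
  apply: hilbert_complete => e e0; have [N Ne] := uc e e0.
  exists N => m n Nm Nn; apply: le_trans (Ne _ _ Nm Nn).
  by rewrite hdot_norm; exact: (dot_coef (u m - u n) k).
pose a k := limn (fun n => u n k).
have tail e : 0 < e -> exists N, forall n, (N <= n)%N -> forall K,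
    \sum_(0 <= k < K) `|u n k - a k| ^+ 2 <= e.
  move=> e0; have [N Ne] := uc e e0; exists N => n Nn K.
  apply: (@complex_lim_le _
    (fun m => \sum_(0 <= k < K) `|u n k - u (m + N)%N k| ^+ 2 : C)).
    move=> m; apply: le_trans (Ne _ _ Nn (leq_addl m N)).
    exact: (dot_sum (u n - u (m + N)%N)).
  apply: (@complex_cvg_sum _ K (fun k m => `|u n k - u (m + N)%N k| ^+ 2)
    (fun k => `|u n k - a k| ^+ 2)) => k.
  apply: cvg_sqr_norm; apply: cvgB; first exact: cvg_cst.
  by have := c k; rewrite -(cvg_shiftn N).
have [N0 N0e] := tail 1 ltr01.
have sa : square_summable a.
  have h : square_summable (fun k => u N0 k - a k).
    by apply/square_summableP; exists 1 => n; exact: N0e.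
  have := square_summable_linear (c := -1) h (H2P (u N0)).
  congr square_summable; apply/funext => k /=.
  by rewrite !fctE scaleN1r opprB subrK.
exists (MkH2 (asboolT sa)) => e e0; have [N Ne] := tail e e0.
by exists N => n Nn; apply: dot_le => K; exact: Ne.
Qed.

HB.instance Definition _ := Lmodule_isHilbert.Build R (H2 F)
  dot_linear dot_conj dot_ge0 dot_eq0 dot_complete.

Lemma H2_hdotE (f g : H2 F) :
  hdot f g = limn (series (fun n => hdot (f n) (g n) : C)).
Proof. by []. Qed.

End H2Hilbert.

Arguments H2P {R F} f.

Section Operators.
Variables (R : realType) (E F : hilbertType R).

Definition bounded_op (T : E -> F) : Prop :=
  linear T /\ exists M : R[i], forall x, `|T x| <= M * `|x|.

Definition contractive (T : E -> F) : Prop :=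
  linear T /\ forall x, `|T x| <= `|x|.

Definition isometric (V : E -> F) : Prop :=
  linear V /\ forall x, `|V x| = `|x|.

Definition unitary (U : E -> F) : Prop :=
  isometric U /\ forall y, exists x, U x = y.

(* For bounded T, the Riesz representation theorem provides, for each y,
   exactly one such z. *)
Definition adj (T : E -> F) (y : F) : E :=
  xget 0 [set z | forall x, hdot (T x) y = hdot x z].

End Operators.

Section Operators1.
Variables (R : realType) (H : hilbertType R).

Definition orthoproj (P : H -> H) : Prop :=
  [/\ linear P, forall x, P (P x) = P x
    & forall x y, hdot (P x) y = hdot x (P y)].

(* A positive operator on a complex Hilbert space is self-adjoint, hence
   bounded, so that boundedness of [B] need not be required. *)
Definition psqrt (A : H -> H) (B : {linear H -> H}) : Prop :=
  (forall x, 0 <= hdot (B x) x) /\ (forall x, B (B x) = A x).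

(* [D] is D_{T^*}. *)
Definition defect_star (T : H -> H) (D : {linear H -> H}) : Prop :=
  psqrt (fun h => h - T (adj T h)) D.

(* [Q] is Q_{T^*}. *)
Definition asymptotic_root (T : H -> H) (Q : {linear H -> H}) : Prop :=
  exists2 A : H -> H,
    forall h, (fun n => iter n T (iter n (adj T) h)) @ \oo --> A h & psqrt A Q.

Definition clspan (A : set H) : set H :=
  [set x | forall S, closed_subspace S -> A `<=` S -> S x].

Definition inv_clspan (ops : set (H -> H)) (A : set H) : set H :=
  [set x | forall S, closed_subspace S -> A `<=` S ->
     (forall B, ops B -> forall y, S y -> S (B y)) -> S x].

Lemma range_subspace (D : {linear H -> H}) :
  range D 0 /\ forall a x y, range D x -> range D y -> range D (a *: x + y).
Proof.
split; first by exists 0; rewrite ?linear0.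
by move=> a _ _ [x _ <-] [y _ <-]; exists (a *: x + y); rewrite ?linearP.
Qed.

Definition clran (D : {linear H -> H}) : csubspace H :=
  CSubspace (closure_subspace (proj1 (range_subspace D))
                              (proj2 (range_subspace D))).

Definition clran_op (D : {linear H -> H}) (h : H) : csub (clran D) :=
  @CSub R H (clran D) (D h) (mem_set (@subset_closure _ _ (D h) (imageT D h))).

End Operators1.

Section H2Operators.
Variables (R : realType) (F : hilbertType R).

(* 0 if [a] is not square-summable. *)
Definition H2mk (a : nat -> F) : H2 F := insubd 0 a.

Lemma H2mkE (a : nat -> F) : square_summable a -> coef (H2mk a) = a.
Proof. by move=> sa; rewrite /H2mk insubdK//; exact: (asboolT sa). Qed.

Definition H2eval (f : H2 F) (z : R[i]) : F :=
  limn (series (fun n => z ^+ n *: f n)).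

End H2Operators.

(* The operators I (x) L and multiplication by A + zB, for bounded L, A, B; see
   [H2mapE], [H2mulE] and [H2eval_mul]. *)
Definition H2map (R : realType) (E F : hilbertType R) (L : E -> F) (f : H2 E) :
  H2 F := H2mk (fun n => L (f n)).

Definition H2mul (R : realType) (F : hilbertType R) (A B : F -> F) (f : H2 F) :
  H2 F := H2mk (fun n => A (f n) + (if n is m.+1 then B (f m) else 0)).

Section H2Eval.
Variables (R : realType).
Implicit Types E F : hilbertType R.

Lemma H2mapE E F (L : E -> F) (f : H2 E) n :
  bounded_op L -> H2map L f n = L (f n).
Proof.
case=> _ [M LM]; rewrite /H2map H2mkE//; apply/square_summableP.
have /square_summableP[N fN] := H2P f.
exists (`|M| ^+ 2 * N) => k; apply: le_trans (ler_wpM2l _ (fN k)); last first.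
  by rewrite exprn_ge0.
rewrite mulr_sumr; apply: ler_sum => i _; rewrite -exprMn.
rewrite ler_sqr ?nnegrE ?mulr_ge0// (le_trans (LM _))//.
rewrite -[leLHS]ger0_norm ?normrM ?normr_id//.
exact: le_trans (LM (f i)).
Qed.

Lemma H2mulE F (A B : F -> F) (f : H2 F) n :
  bounded_op A -> bounded_op B ->
  H2mul A B f n = A (f n) + (if n is m.+1 then B (f m) else 0).
Proof.
move=> bA bB; rewrite /H2mul H2mkE//.
have sA : square_summable (fun n => A (f n)).
  have := H2P (H2map A f); congr square_summable.
  by apply/funext => k; exact: H2mapE.
have /square_summableP[N fN] : square_summable (fun n => B (f n)).
  have := H2P (H2map B f); congr square_summable.
  by apply/funext => k; exact: H2mapE.
have sB : square_summable (fun n => if n is m.+1 then B (f m) else 0).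
  apply/square_summableP; exists N => -[|k].
    by have := fN 0; rewrite !big_nil.
  by rewrite big_nat_recl//= normr0 expr0n add0r; exact: fN.
have := square_summable_linear (c := 1) sA sB; congr square_summable.
by apply/funext => k; rewrite !fctE scale1r.
Qed.

Lemma norm_coef F (f : H2 F) n : `|f n| <= `|f|.
Proof.
rewrite -ler_sqr ?nnegrE// -[leRHS]hdot_norm H2_hdotE.
have fE : (fun n => hdot (f n) (f n) : R[i]^o) = (fun n => `|f n| ^+ 2 : R[i]^o).
  by apply/funext => k; rewrite hdot_norm.
rewrite fE; apply: le_trans (@series_le_lim _ _ n.+1 _ (H2P f)).
  rewrite /series /= big_nat_recr //= lerDr.
  by apply: sumr_ge0 => k _; rewrite exprn_ge0.
by move=> k; rewrite exprn_ge0.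
Qed.

Lemma abs_series_cvg F (u : nat -> F) :
  cvgn (series (fun n => `|u n| : R[i]^o)) -> cvgn (series u).
Proof.
move=> uc; apply: hilbert_complete => e e0.
have e20 : 0 < sqrtC e / 2 by rewrite divr_gt0 ?sqrtC_gt0.
have [N _ Ne] := (@cvgrPdist_le _ R[i]^o _ _ _ _ _).1 uc _ e20.
exists N => m n Nm Nn.
wlog nm : m n Nm Nn / (n <= m)%N => [hw|].
  have [|mn] := leqP n m; first exact: hw.
  by rewrite hdot_norm distrC -hdot_norm; apply: hw => //; exact: ltnW.
rewrite hdot_norm -[leRHS]sqrtCK ler_sqr ?nnegrE ?sqrtC_ge0 ?(ltW e0)//.
rewrite sub_series_geq//; apply: (le_trans (ler_norm_sum _ _ _)).
rewrite -(@sub_series_geq _ (fun n => `|u n| : R[i]^o))//.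
rewrite -[leLHS]ger0_norm; last first.
  by rewrite sub_series_geq//; exact: sumr_ge0.
set l := limn _ in Ne.
rewrite -(subrKA l) (splitr (sqrtC e)) (le_trans (ler_normD _ _))// lerD//.
  by rewrite distrC; exact: Ne.
exact: Ne.
Qed.

Lemma geometric_sum_le (r : R[i]) n : 0 <= r < 1 ->
  \sum_(0 <= k < n) r ^+ k <= (1 - r)^-1.
Proof.
move=> /andP[r0 r1]; rewrite -[leRHS]mul1r ler_pdivlMr ?subr_gt0// mulrC.
rewrite -opprB mulNr big_mkord -subrX1 opprB gerBl.
exact: exprn_ge0.
Qed.

Lemma H2eval_cvg F (f : H2 F) (z : R[i]) : `|z| < 1 ->
  series (fun n => z ^+ n *: f n) @ \oo --> H2eval f z.
Proof.
move=> z1; apply: abs_series_cvg.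
apply: (@ge0_series_cvg _ _ ((1 - `|z|)^-1 * `|f|)) => // n.
rewrite /series /=.
apply: (@le_trans _ _ (\sum_(0 <= k < n) `|z| ^+ k * `|f|)).
  apply: ler_sum => k _; rewrite normrZ normrX ler_wpM2l ?exprn_ge0//.
  exact: norm_coef.
by rewrite -mulr_suml ler_wpM2r// geometric_sum_le// normr_ge0.
Qed.

Lemma bounded_op_cvg E F (A : E -> F) (u : nat -> E) l :
  bounded_op A -> u @ \oo --> l -> (fun n => A (u n)) @ \oo --> A l.
Proof.
move=> [Al [M AM]] /cvgrPdist_le ul; apply/cvgrPdist_le => e e0.
have d0 : 0 < e / (1 + `|M|) by rewrite divr_gt0 ?ltr_wpDr.
apply: filterS (ul _ d0) => n /= h.
have -> : A l - A (u n) = A (l - u n).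
  by rewrite addrC -scaleN1r -Al scaleN1r addrC.
have MA : M * `|l - u n| <= `|M| * `|l - u n|.
  have := le_trans (normr_ge0 _) (AM (l - u n)).
  by move=> /ger0_norm <-; rewrite normrM normr_id.
apply: le_trans (AM _) _; apply: le_trans MA _.
apply: (@le_trans _ _ ((1 + `|M|) * (e / (1 + `|M|)))).
  by rewrite ler_pM// ?lerDr.
by rewrite mulrC divfK// gt_eqF// ltr_wpDr.
Qed.

Lemma H2eval_mul F (A B : F -> F) (f : H2 F) (z : R[i]) :
  bounded_op A -> bounded_op B -> `|z| < 1 ->
  H2eval (H2mul A B f) z = A (H2eval f z) + z *: B (H2eval f z).
Proof.
move=> bA bB z1.
suff h : series (fun n => z ^+ n *: H2mul A B f n) @ \oo -->
    A (H2eval f z) + z *: B (H2eval f z).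
  exact (@norm_cvg_unique _ F _ _ _ _ (H2eval_cvg z1) h).
have fz := H2eval_cvg (f := f) z1.
have fz1 : (fun n => series (fun n => z ^+ n *: f n) (n + 1)%N) @ \oo
    --> H2eval f z by rewrite (cvg_shiftn 1 (series (fun n => z ^+ n *: f n))).
rewrite -(cvg_shiftn 1 (series _)).
have -> : (fun n => series (fun n => z ^+ n *: H2mul A B f n) (n + 1)%N) =
    (fun n => A (series (fun n => z ^+ n *: f n) (n + 1)%N) +
              z *: B (series (fun n => z ^+ n *: f n) n)).
  apply/funext => n; rewrite addn1 /series /=.
  pose A' : {linear F -> F} := HB.pack A (GRing.isLinear.Build _ _ _ _ A bA.1).
  pose B' : {linear F -> F} := HB.pack B (GRing.isLinear.Build _ _ _ _ B bB.1).
  rewrite -[A]/(A' : F -> F) -[B]/(B' : F -> F).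
  rewrite !linear_sum /= big_nat_recl// [in RHS]big_nat_recl//.
  rewrite H2mulE// addr0 expr0 !scale1r -addrA -big_split /=; congr (_ + _).
  apply: eq_bigr => k _; rewrite H2mulE// scalerDr.
  have AZ a x : A (a *: x) = a *: A x by exact: (linearZ_LR A').
  have BZ a x : B (a *: x) = a *: B x by exact: (linearZ_LR B').
  by rewrite AZ BZ scalerA exprS.
have h1 := bounded_op_cvg bA fz1; have h2 := bounded_op_cvg bB fz.
exact (cvgD h1 (@cvgZl_tmp _ _ _ _ _ z _ _ h2)).
Qed.

Lemma H2eval_eq0 F (f : H2 F) :
  (forall z : R[i], `|z| < 1 -> H2eval f z = 0) -> forall n, f n = 0.
Proof.
move=> f0; elim/ltn_ind => m IH; apply/eqP; rewrite -normr_eq0 -[_ == _]negbK.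
apply/negP => fm0.
have d0 : 0 < `|f m| by rewrite lt_def fm0 normr_ge0.
have N0 : 0 < `|f| by apply: lt_le_trans d0 (norm_coef f m).
pose z : R[i] := `|f m| / (4 * `|f|).
have z0 : 0 < z by rewrite divr_gt0// mulr_gt0.
have z4 : z <= 4^-1.
  rewrite /z invfM mulrCA ler_piMr ?invr_ge0//.
  by rewrite ler_pdivrMr// mul1r norm_coef.
have z2 : (1 - z)^-1 <= 2.
  rewrite -[leRHS]invrK lef_pV2 ?posrE ?invr_gt0// ?subr_gt0.
    rewrite lerBrDr -lerBrDl (le_trans z4)//.
    have -> : 1 - 2^-1 = 2^-1 :> R[i].
      by rewrite {1}(splitr (1 : R[i])) mul1r addrK.
    by rewrite lef_pV2 ?posrE// ler_nat.
  by rewrite (le_lt_trans z4)// invf_lt1// ltr1n.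
have z1 : `|z| < 1.
  by rewrite ger0_norm ?(ltW z0)// (le_lt_trans z4)// invf_lt1// ltr1n.
have zN k : `|z ^+ k| = z ^+ k by rewrite ger0_norm// exprn_ge0// ltW.
pose S := series (fun n => z ^+ n *: f n).
have Scv : S @ \oo --> (0 : F) by rewrite -(f0 z z1); exact: H2eval_cvg.
have SE p : S (p + m.+1)%N =
    z ^+ m *: f m + \sum_(0 <= k < p) z ^+ (k + m.+1) *: f (k + m.+1)%N.
  rewrite /S /series /= (@big_cat_nat _ _ _ m.+1)//= ?leq_addl//.
  rewrite (@big_nat_recr _ _ _ m 0 _ (leq0n m)) /=.
  rewrite big1_seq ?add0r => [|k]; last first.
    by rewrite mem_index_iota => /andP[_ km]; rewrite IH// scaler0.
  by rewrite -{1}[m.+1]add0n big_addn addnK.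
have Sle p : z ^+ m * `|f m| - 2 * z ^+ m.+1 * `|f| <= `|S (p + m.+1)%N|.
  rewrite lerBlDr -{1}(zN m) -normrZ.
  have -> : z ^+ m *: f m = S (p + m.+1)%N -
      \sum_(0 <= k < p) z ^+ (k + m.+1) *: f (k + m.+1)%N by rewrite SE addrK.
  rewrite (le_trans (ler_normB _ _))// lerD2l (le_trans (ler_norm_sum _ _ _))//.
  apply: (@le_trans _ _ (\sum_(0 <= k < p) z ^+ k * (z ^+ m.+1 * `|f|))).
    apply: ler_sum => k _; rewrite normrZ zN exprD -mulrA.
    by rewrite !ler_wpM2l ?exprn_ge0 ?(ltW z0)// norm_coef.
  rewrite -mulr_suml -mulrA ler_wpM2r ?mulr_ge0 ?exprn_ge0 ?(ltW z0)//.
  apply: le_trans z2; apply: geometric_sum_le; rewrite (ltW z0)/=.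
  by rewrite (le_lt_trans z4)// invf_lt1// ltr1n.
have lim0 : (fun p => `|S (p + m.+1)%N| : R[i]^o) @ \oo --> (`|0 : F| : R[i]^o).
  have h : (fun p => S (p + m.+1)%N) @ \oo --> (0 : F).
    by rewrite (cvg_shiftn m.+1 S).
  exact (cvg_norm h).
have : 0 <= `|0 : F| - (z ^+ m * `|f m| - 2 * z ^+ m.+1 * `|f|).
  apply: (@complex_lim_ge0 _ (fun p =>
    `|S (p + m.+1)%N| - (z ^+ m * `|f m| - 2 * z ^+ m.+1 * `|f|) : R[i]^o)).
    by move=> p; rewrite subr_ge0.
  exact (@cvgB _ R[i]^o _ _ _ _ _ _ _ lim0 (cvg_cst _)).
rewrite normr0 sub0r oppr_ge0 exprSr.
have -> : z ^+ m * `|f m| - 2 * (z ^+ m * z) * `|f| =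
    z ^+ m * (`|f m| - 2 * z * `|f|) by ring.
rewrite pmulr_rle0 ?exprn_gt0// subr_le0.
have -> : 2 * z * `|f| = `|f m| / 2.
  rewrite /z; field.
  by rewrite gt_eqF.
by rewrite ler_pdivlMr// ger_pMr// lern1.
Qed.

Lemma H2eval_inj F (f g : H2 F) :
  (forall z : R[i], `|z| < 1 -> H2eval f z = H2eval g z) -> f = g.
Proof.
move=> fg; apply/eqP; rewrite -subr_eq0; apply/eqP/val_inj/funext => n.
apply: (@H2eval_eq0 F (f - g)) => z z1.
have -> : (0 : F) = H2eval f z - H2eval g z by rewrite fg// subrr.
have h : series (fun n => z ^+ n *: (f - g) n) @ \oo -->
    H2eval f z - H2eval g z.
  have -> : series (fun n => z ^+ n *: (f - g) n) =
      (fun n => series (fun n => z ^+ n *: f n) n -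
                series (fun n => z ^+ n *: g n) n).
    apply/funext => k; rewrite /series /= -sumrB.
    by apply: eq_bigr => i _; rewrite -scalerBr.
  exact (cvgB (H2eval_cvg z1) (H2eval_cvg z1)).
exact (@norm_cvg_unique _ F _ _ _ _ (H2eval_cvg z1) h).
Qed.

End H2Eval.

Section MinimalUnitaryExtension.
Variables (R : realType) (H : hilbertType R).

(* [iota] embeds the space of the isometry [X] into that of its extension [U];
   minimality means that no proper reducing subspace contains the image. *)
Definition min_unitary_ext (E K : hilbertType R) (X : E -> E) (iota : E -> K)
    (U : K -> K) : Prop :=
  [/\ isometric iota, unitary U, forall x, U (iota x) = iota (X x)
    & inv_clspan [set U; adj U] (range iota) = setT].

(* [WD] is W_D itself, so that it is its adjoint that extends X^*, the isometry
   [Xs] on the closure of Ran Q_{T^*}. *)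
Definition canonical_unitary (T : H -> H) (Q : {linear H -> H})
    (QT : hilbertType R) (iota : csub (clran Q) -> QT) (WD : QT -> QT) : Prop :=
  unitary WD /\
  exists Xs : csub (clran Q) -> csub (clran Q),
    [/\ isometric Xs, forall h, Xs (clran_op Q h) = clran_op Q (adj T h)
      & min_unitary_ext Xs iota (adj WD)].

Definition flat_pair (T1 T2 : H -> H) (Q : {linear H -> H})
    (QT : hilbertType R) (iota : csub (clran Q) -> QT) (WD W1 W2 : QT -> QT) :
    Prop :=
  [/\ unitary W1 /\ unitary W2,
      forall y, W1 (W2 y) = W2 (W1 y),
      forall y, W1 (W2 y) = WD y,
      forall h, adj W1 (iota (clran_op Q h)) = iota (clran_op Q (adj T1 h))
    & forall h, adj W2 (iota (clran_op Q h)) = iota (clran_op Q (adj T2 h))].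

End MinimalUnitaryExtension.

Section AndoLift.
Variables (R : realType) (H : hilbertType R) (T1 T2 : H -> H).

Definition ando_lift (K : hilbertType R) (Pi : H -> K) (V1 V2 : K -> K) : Prop :=
  [/\ isometric Pi, isometric V1 /\ isometric V2,
      forall x, V1 (V2 x) = V2 (V1 x),
      forall h, adj V1 (Pi h) = Pi (adj T1 h)
    & forall h, adj V2 (Pi h) = Pi (adj T2 h)].

Definition minimal_ando_lift (K : hilbertType R) (Pi : H -> K) (V1 V2 : K -> K) :
    Prop :=
  ando_lift Pi V1 V2 /\
  clspan [set x | exists n1 n2 h, x = iter n1 V1 (iter n2 V2 (Pi h))] = setT.

Definition lift_unitarily_equivalent (K K' : hilbertType R)
    (Pi : H -> K) (V1 V2 : K -> K) (Pi' : H -> K') (V1' V2' : K' -> K') : Prop :=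
  exists tau : K -> K',
    [/\ unitary tau, forall h, tau (Pi h) = Pi' h,
        forall x, tau (V1 x) = V1' (tau x) & forall x, tau (V2 x) = V2' (tau x)].

End AndoLift.

Section AndoTuple.
Variables (R : realType) (H : hilbertType R) (T1 T2 : H -> H).
Variables (D : {linear H -> H}) (F : hilbertType R).
Variables (Lam : csub (clran D) -> F) (P U : F -> F).

Local Notation Pperp := (fun x => x - P x).
Local Notation LamD := (fun h => Lam (clran_op D h)).

(* A tuple for the pair of the adjoints of T1 and T2; [D] is meant to be D_{T^*},
   where T = T1 T2. *)
Definition type_I_ando_tuple : Prop :=
  [/\ isometric Lam, orthoproj P, unitary U,
      forall h, Pperp (U (LamD h)) + P (U (LamD (adj (T1 \o T2) h))) =
                LamD (adj T1 h)
    & forall h, adj U (P (LamD h)) + adj U (Pperp (LamD (adj (T1 \o T2) h))) =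
                LamD (adj T2 h)].

(* M_{U^*(P^perp + zP)} and M_{(P + z P^perp)U} *)
Definition ando_mul1 : H2 F -> H2 F :=
  H2mul (fun x => adj U (Pperp x)) (fun x => adj U (P x)).

Definition ando_mul2 : H2 F -> H2 F :=
  H2mul (fun x => P (U x)) (fun x => Pperp (U x)).

(* H^2(A) for a closed subspace [A] of F *)
Definition H2_of (A : set F) : set (H2 F) := [set f | forall n, A (f n)].

Definition douglas_minimal : Prop :=
  inv_clspan [set ando_mul1; ando_mul2] (H2_of (range Lam)) = setT.

(* The sequence is square-summable because D^2 = I - T T^* makes the sum of the
   |D T^*n h|^2 telescope. *)
Definition observability (T : H -> H) (h : H) : H2 (csub (clran D)) :=
  H2mk (fun n => clran_op D (iter n (adj T) h)).

Variables (Q : {linear H -> H}) (QT : hilbertType R).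

Definition block_diag (A : H2 F -> H2 F) (W : QT -> QT) (x : hsum (H2 F) QT) :
  hsum (H2 F) QT := (A x.1, W x.2).

Definition model_Pi (iota : csub (clran Q) -> QT) (h : H) : hsum (H2 F) QT :=
  (H2map Lam (observability (T1 \o T2) h), iota (clran_op Q h)).

Definition model_V1 (W1 : QT -> QT) : hsum (H2 F) QT -> hsum (H2 F) QT :=
  block_diag ando_mul1 W1.

Definition model_V2 (W2 : QT -> QT) : hsum (H2 F) QT -> hsum (H2 F) QT :=
  block_diag ando_mul2 W2.

End AndoTuple.

(* Main.v *)
Require Import Defs.
From mathcomp Require Import all_boot all_order all_algebra.
From mathcomp Require Import complex.
From mathcomp Require Import boolp classical_sets functions reals topology
  normedtype sequences.
From mathcomp Require Import ring.

Set Implicit Arguments.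
Unset Strict Implicit.
Unset Printing Implicit Defensive.

Import Order.TTheory GRing.Theory Num.Theory.
Import numFieldNormedType.Exports.

Local Open Scope ring_scope.
Local Open Scope classical_set_scope.

(* An Ando lift (Pi, V1, V2) is analysed through V = V1 V2.  For the model, Pi h and
   V Pi (T^* h) differ only in the constant coefficient Lambda D h, so the span of
   the lift contains H^2(Ran Lambda), hence H^2(F) by Douglas-minimality, hence also
   Ran Q and its forward orbit under W_D, which is total.

   Conversely, the Berger-Coburn-Lebow construction on F = ker V^* gives P and U, and
   the Fourier map x |-> (n |-> (1 - V V^* ) V^*n x) intertwines V1, V2 with the two
   multiplications; Lambda sends D h to (1 - V V^* ) Pi h.  The Wold decomposition is
   not needed: for x = V1^a V2^b Pi h and m >= a, b one has V^*m x = Pi k with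
   k = T1^*(m - a) T2^*(m - b) h, so <x, x'> exceeds the inner product of the Fourier
   transforms by lim <V^*n x, V^*n x'> = <Q k, Q k'>.  The Gram matrix of these total
   vectors is therefore the same as in the model, which yields the unitary. *)

(** Taken at [iter n (adj T) h], the two equations of a Type I tuple say, coefficient by
    coefficient, that the adjoints of the two multiplications act on the Hardy component of Pi h as
    [adj T1] and [adj T2]; this explains their shape. In the converse they come from two identities
    for 1 - V V^* that hold on all of K, evaluated at Pi h. Because V^* V2 = V1^* and V^* V1 = V2^*,
    the same identities with indices crossed make the Fourier map intertwine.

    The obstacle in the converse is that the Fourier map is only a contraction: its kernel is the
    part of K on which V is unitary. Gram matrices spare the identification of that part with the
    space of W_D. In the model W_D is unitary, so an m-th power of its adjoint reduces each inner
    product to one of Q-vectors exactly; in the lift the same quantity appears as a limit. The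
    direct half returns at the end: it makes the model vectors total, so that the isometry obtained
    from the Gram matrices is onto. *)

(** * Linear maps, inner products and isometries *)

Section LinearMaps.
Variables (R : realType) (E F : hilbertType R) (T : E -> F).
Hypothesis Tl : linear T.

Lemma linear_mapD x y : T (x + y) = T x + T y.
Proof. by rewrite -[x]scale1r Tl !scale1r. Qed.

Lemma linear_map0 : T 0 = 0.
Proof. by apply/eqP; rewrite -(subrr (T 0)) eq_sym subr_eq -linear_mapD addr0. Qed.

Lemma linear_mapZ a x : T (a *: x) = a *: T x.
Proof. by rewrite -[a *: x]addr0 Tl linear_map0 addr0. Qed.

Lemma linear_mapB x y : T (x - y) = T x - T y.
Proof. by rewrite -scaleN1r linear_mapD linear_mapZ scaleN1r. Qed.

End LinearMaps.

Section InnerProduct.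
Variables (R : realType) (E : hilbertType R).
Implicit Types x y z : E.

Lemma hdot0l z : hdot 0 z = 0.
Proof. by rewrite -(scale0r (0 : E)) hdotZl mul0r. Qed.

Lemma hdot0r z : hdot z 0 = 0.
Proof. by rewrite hdot_conj hdot0l rmorph0. Qed.

Lemma hdotBl x y z : hdot (x - y) z = hdot x z - hdot y z.
Proof. by rewrite hdotDl -scaleN1r hdotZl mulN1r. Qed.

Lemma hdotBr x y z : hdot z (x - y) = hdot z x - hdot z y.
Proof. by rewrite hdot_conj hdotBl rmorphB /= -!hdot_conj. Qed.

Lemma hdot_inj y z : (forall x, hdot x y = hdot x z) -> y = z.
Proof.
move=> h; apply/eqP; rewrite -subr_eq0; apply/eqP/hdot_eq0.
by rewrite hdotBr h subrr.
Qed.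

Lemma cvg_hdotl (u : nat -> E) l y : u @ \oo --> l ->
  (fun n => hdot (u n) y : R[i]^o) @ \oo --> (hdot l y : R[i]^o).
Proof.
move=> /cvgrPdist_le ul; apply/(@cvgrPdist_le _ R[i]^o) => e e0.
have y0 : 0 < 1 + `|y| by rewrite ltr_wpDr.
apply: filterS (ul _ (divr_gt0 e0 y0)) => n /= h.
rewrite -hdotBl; apply: le_trans (CauchySchwarz_hdot _ _) _.
apply: (@le_trans _ _ (e / (1 + `|y|) * (1 + `|y|))).
  by rewrite ler_pM// lerDr.
by rewrite divfK// gt_eqF.
Qed.

End InnerProduct.

Lemma isometric_hdot (R : realType) (E F : hilbertType R) (V : E -> F) x y :
  isometric V -> hdot (V x) (V y) = hdot x y.
Proof.
move=> [Vl Vn]; rewrite !polarization !Vn.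
by rewrite -(linear_mapD Vl) -(linear_mapZ Vl) -(linear_mapD Vl) !Vn.
Qed.

Lemma hdot_isometric (R : realType) (E F : hilbertType R) (V : E -> F) :
  linear V -> (forall x, hdot (V x) (V x) = hdot x x) -> isometric V.
Proof.
move=> Vl Vh; split=> // x; apply/eqP.
by rewrite -(@eqrXn2 _ 2)// -!hdot_norm Vh.
Qed.

Lemma isometric_bounded (R : realType) (E F : hilbertType R) (V : E -> F) :
  isometric V -> bounded_op V.
Proof. by move=> [Vl Vn]; split=> //; exists 1 => x; rewrite Vn mul1r. Qed.

Lemma contractive_bounded (R : realType) (E F : hilbertType R) (V : E -> F) :
  contractive V -> bounded_op V.
Proof. by move=> [Vl Vn]; split=> //; exists 1 => x; rewrite mul1r. Qed.

(** The order of [R[i]] compares only numbers with equal imaginary parts, so the infimum is that of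
    the real parts; nonnegativity makes all members real. *)
Lemma complex_inf (R : realType) (S : set R[i]) : S !=set0 ->
  (forall x, S x -> 0 <= x) ->
  exists d, (forall x, S x -> d <= x) /\
    forall e, 0 < e -> exists2 x, S x & x < d + e.
Proof.
move=> [x0 Sx0] S0.
have SE x : S x -> x = (complex.Re x)%:C%C.
  by move=> /S0 x_ge0; rewrite RRe_real// ger0_real.
pose A := [set complex.Re x | x in S].
have infA : has_inf A.
  split; first by exists (complex.Re x0), x0.
  exists 0 => _ [x Sx <-].
  by have := S0 x Sx; rewrite {1}(SE _ Sx) -[0]/(0%:C%C) lecR.
exists (inf A)%:C%C; split=> [x Sx|[e e']].
  by rewrite (SE x Sx) lecR; apply: ge_inf; [exact: infA.2|exists x].
rewrite ltcE /= => /andP[/eqP -> e0].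
have [_ [x Sx <-] xe] := inf_adherent e0 infA.
by exists x => //; rewrite (SE x Sx) -rmorphD /= ltcR.
Qed.

(** * Riesz representation *)

Section Riesz.
Variables (R : realType) (E : hilbertType R).

Lemma parallelogram (x y : E) :
  `|x - y| ^+ 2 = 2 * `|x| ^+ 2 + 2 * `|y| ^+ 2 - 4 * `|2^-1 *: (x + y)| ^+ 2.
Proof.
rewrite normrZ exprMn normfV ger0_norm// exprVn.
have -> : (2 : R[i]) ^+ 2 = 4 by rewrite -natrX.
rewrite mulVKf ?pnatr_eq0// -!hdot_norm !hdotBl !hdotBr !hdotDl !hdotDr.
set a := hdot x x; set b := hdot x y; set c := hdot y x; set d := hdot y y.
by ring.
Qed.

Lemma min_norm_orthogonal (z w : E) :
  (forall a, `|z| ^+ 2 <= `|z - a *: w| ^+ 2) -> hdot z w = 0.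
Proof.
move=> zmin; have [w0|w0] := eqVneq (hdot w w) 0.
  by rewrite (hdot_eq0 w0) hdot0r.
have wp : 0 < hdot w w by rewrite lt_def w0 hdot_ge0.
(* This [a] minimises |z - a w|: the square drops by |<z, w>|^2 / <w, w>, which minimality forces to
   vanish. *)
pose a := hdot z w / hdot w w; have := zmin a.
have aE : a * hdot w w = hdot z w by rewrite /a divfK.
have -> : `|z - a *: w| ^+ 2 = `|z| ^+ 2 - a * hdot w z.
  rewrite -!hdot_norm hdotBl !hdotBr !hdotZl !hdotZr -aE; clearbody a; by ring.
rewrite lerDl oppr_ge0 => h.
have {h} : a * hdot w z * hdot w w <= 0 by rewrite pmulr_lle0.
rewrite mulrAC aE (hdot_conj w z) -normCK => h.
apply/eqP; rewrite -normr_eq0 -sqrf_eq0 eq_le h exprn_ge0//.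
Qed.

(** The representing vector is a multiple of the point of least norm on the affine hyperplane f = 1,
    found as the limit of a minimising sequence. *)
Lemma riesz (f : E -> R[i]) (M : R[i]) :
  (forall a x y, f (a *: x + y) = a * f x + f y) ->
  (forall x, `|f x| <= M * `|x|) ->
  exists z, forall x, f x = hdot x z.
Proof.
move=> flin fM.
have fD x y : f (x + y) = f x + f y by rewrite -[x]scale1r flin scale1r mul1r.
have f0 : f 0 = 0.
  by have := fD 0 0; rewrite addr0 => /eqP; rewrite addrC -subr_eq subrr => /eqP.
have fZ a x : f (a *: x) = a * f x by rewrite -[a *: x]addr0 flin f0 addr0.
have fB x y : f (x - y) = f x - f y by rewrite fD -scaleN1r fZ mulN1r.
have [[x0 fx0]|fz] := pselect (exists x, f x != 0); last first.
  exists 0 => x; rewrite hdot0r; apply/eqP/negPn/negP => fx.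
  by apply: fz; exists x.
have [|_ [x _ <-]|d [dle dlt]] :=
    @complex_inf R [set `|x| ^+ 2 | x in [set x | f x = 1]].
- exists (`|(f x0)^-1 *: x0| ^+ 2), ((f x0)^-1 *: x0) => //=.
  by rewrite fZ mulVf.
- by rewrite exprn_ge0.
have {}dle x : f x = 1 -> d <= `|x| ^+ 2 by move=> fx; apply: dle; exists x.
have /choice[u uP] : forall n : nat, exists x, f x = 1 /\ `|x| ^+ 2 < d + n.+1%:R^-1.
  move=> n; have [|_ [x /= fx <-] xd] := dlt n.+1%:R^-1.
    by rewrite invr_gt0 ltr0n.
  by exists x.
have uu m n : `|u m - u n| ^+ 2 <= 2 * m.+1%:R^-1 + 2 * n.+1%:R^-1.
  rewrite parallelogram.
  (* The midpoint still satisfies f = 1, so its squared norm is at least [d]; the parallelogram law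
     then makes the sequence Cauchy. *)
  have := dle (2^-1 *: (u m + u n)).
  rewrite fZ fD (uP m).1 (uP n).1 mulVf ?pnatr_eq0// => /(_ erefl) h.
  have h1 := ltW (uP m).2; have h2 := ltW (uP n).2.
  apply: (@le_trans _ _ (2 * (d + m.+1%:R^-1) + 2 * (d + n.+1%:R^-1) - 4 * d)).
    by rewrite lerB ?lerD ?ler_wpM2l.
  rewrite le_eqVlt; apply/orP; left; apply/eqP.
  set a := m.+1%:R^-1; set b := n.+1%:R^-1.
  by ring.
have le_d m n : (n <= m)%N -> (m.+1%:R^-1 : R[i]) <= n.+1%:R^-1.
  by move=> nm'; rewrite lef_pV2 ?posrE ?ltr0n// ler_nat.
have uc : cvgn u.
  apply: hilbert_complete => e e0.
  have e40 : 0 < e / 4 by rewrite divr_gt0.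
  have [N Ne] := complex_archi e40; exists N => m n Nm Nn.
  rewrite hdot_norm (le_trans (uu m n))//.
  apply: (@le_trans _ _ (2 * (e / 4) + 2 * (e / 4))).
    rewrite lerD// ler_wpM2l//; apply: le_trans (ltW Ne); exact: le_d.
  rewrite le_eqVlt; apply/orP; left; apply/eqP.
  by field.
pose z := limn u.
have fz : f z = 1.
  apply/eqP; rewrite -subr_eq0 -normr_eq0 eq_le normr_ge0 andbT.
  apply/ler_addgt0Pr => e e0; rewrite add0r.
  (* A divisor is needed, and nothing forces [M] itself to be positive. *)
  have M0 : 0 < 1 + `|M| by rewrite ltr_wpDr.
  have /cvgrPdist_le/(_ _ (divr_gt0 e0 M0))/filter_ex[n] := uc.
  rewrite -/z => zu.
  have -> : f z - 1 = f (z - u n) by rewrite fB (uP n).1.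
  apply: (@le_trans _ _ ((1 + `|M|) * (e / (1 + `|M|)))); last first.
    by rewrite mulrC divfK// gt_eqF.
  apply: (@le_trans _ _ ((1 + `|M|) * `|z - u n|)); last by rewrite ler_wpM2l// ltW.
  rewrite -[leLHS]normr_id; apply: (@le_trans _ _ `|M * `|z - u n| |).
    by rewrite normr_id [leRHS]ger0_norm ?fM//; apply: le_trans (fM _).
  by rewrite normrM normr_id ler_wpM2r// lerDr.
have zd : `|z| ^+ 2 <= d.
  apply/ler_addgt0Pr => e e0.
  have [N Ne] := complex_archi e0.
  have uz := cvg_sqr_norm (uc : u @ \oo --> z).
  apply: (@complex_lim_le R (fun n => `|u (n + N)%N| ^+ 2)).
    move=> n; apply: le_trans (ltW (uP _).2) _; rewrite lerD2l.
    by apply: le_trans (ltW Ne); apply: le_d; exact: leq_addl.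
  by move: uz; rewrite -(cvg_shiftn N).
have zn0 : `|z| ^+ 2 != 0.
  rewrite sqrf_eq0 normr_eq0; apply: contra_eq_neq fz => ->.
  by rewrite f0 eq_sym oner_eq0.
exists ((`|z| ^+ 2)^-1 *: z) => x.
(* Translating [z] along ker f stays on the hyperplane, so minimality makes [z] orthogonal to ker f,
   which contains x - f(x) z. *)
have /(_ (x - f x *: z)) h : forall w, f w = 0 -> hdot w z = 0.
  move=> w fw; rewrite hdot_conj; apply/eqP; rewrite conjC_eq0; apply/eqP.
  apply: min_norm_orthogonal => a; apply: le_trans zd _; apply: dle.
  by rewrite fB fZ fw mulr0 subr0.
have := h _; rewrite fB fZ fz mulr1 subrr hdotBl hdotZl => /(_ erefl) /eqP.
rewrite subr_eq0 hdot_norm hdotZr => /eqP ->.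
by rewrite conj_Creal ?rpredV ?rpredX ?normr_real// mulrCA mulVf// mulr1.
Qed.
End Riesz.

(** * Adjoints *)

Section Adjoint.
Variables (R : realType) (E F : hilbertType R).
Implicit Types T : E -> F.

(** [adj] is a choice with default 0; inner products separate points, so a vector with the defining
    property is the chosen one. *)
Lemma adj_unique T y z : (forall x, hdot (T x) y = hdot x z) -> adj T y = z.
Proof.
move=> Tz; apply: hdot_inj => x; rewrite -Tz.
rewrite /adj; case: xgetP => [w -> /= wP|/(_ z) h]; [by rewrite wP|by case: h].
Qed.

Lemma adjP T : bounded_op T -> forall x y, hdot (T x) y = hdot x (adj T y).
Proof.
move=> [Tl [M TM]] x y.
have [|w|z zP] := @riesz _ _ (fun x => hdot (T x) y) (`|y| * M).
- by move=> a u v; rewrite Tl hdot_linearl.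
- rewrite (le_trans (CauchySchwarz_hdot _ _))// mulrC -mulrA.
  by rewrite ler_wpM2l.
by rewrite zP (adj_unique zP).
Qed.

Lemma adjPr T : bounded_op T -> forall x y, hdot (adj T y) x = hdot y (T x).
Proof. by move=> bT x y; rewrite hdot_conj -adjP// -hdot_conj. Qed.

Lemma adj_linear T : bounded_op T -> linear (adj T).
Proof.
move=> bT a x y; apply: adj_unique => z.
by rewrite !hdotDr !hdotZr -!adjP.
Qed.

Lemma isometric_adjK (V : E -> F) : isometric V -> cancel V (adj V).
Proof. by move=> Vi x; apply: adj_unique => z; rewrite isometric_hdot. Qed.

Lemma unitary_adjK (V : E -> F) : unitary V -> cancel (adj V) V.
Proof. by move=> [Vi Vs] y; have [x <-] := Vs y; rewrite isometric_adjK. Qed.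

End Adjoint.

Lemma adj_comp (R : realType) (E F G : hilbertType R) (S : F -> G) (T : E -> F) :
  bounded_op S -> bounded_op T -> adj (S \o T) = adj T \o adj S.
Proof.
move=> bS bT; apply/funext => y; apply: adj_unique => x /=.
by rewrite adjP// adjP.
Qed.

(** * Closed subspaces and total sets *)

Section ClosedSubspaces.
Variables (R : realType).
Implicit Types E F : hilbertType R.

Lemma closed_subspace_preimage E F (B : E -> F) (S : set F) :
  bounded_op B -> closed_subspace S -> closed_subspace (B @^-1` S).
Proof.
move=> [Bl [M BM]] [S0 Sl Sc]; split.
- by rewrite /preimage /= (linear_map0 Bl).
- by move=> a x y Sx Sy; rewrite /preimage /= Bl; exact: Sl.
- move=> x /closureNP Sx; apply: Sc; apply/closureNP => e e0.
  have M0 : 0 < 1 + `|M| by rewrite ltr_wpDr.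
  have [y Sy xy] := Sx _ (divr_gt0 e0 M0); exists (B y) => //.
  rewrite -(linear_mapB Bl).
  apply: (@le_lt_trans _ _ ((1 + `|M|) * `|x - y|)); last first.
    by rewrite -ltr_pdivlMl// mulrC.
  apply: (@le_trans _ _ `|M * `|x - y| |).
    by rewrite [leRHS]ger0_norm ?BM//; apply: le_trans (BM _).
  by rewrite normrM normr_id ler_wpM2r// lerDr.
Qed.

Lemma closed_subspace_bigcap E (I : Type) (S : I -> set E) :
  (forall i, closed_subspace (S i)) -> closed_subspace [set x | forall i, S i x].
Proof.
move=> Scl; split=> [i|a x y Sx Sy i|x Sx i]; have [S0 Sl Sc] := Scl i.
- exact: S0.
- by apply: Sl; [exact: Sx|exact: Sy].
- by apply: Sc; apply: closure_subset Sx => y; exact.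
Qed.

Lemma closed_subspace_orthogonal E (y : E) :
  closed_subspace [set x | hdot x y = 0].
Proof.
split=> [|a u v /= hu hv|x /closureNP Sx]; rewrite /=.
- exact: hdot0l.
- by rewrite hdot_linearl hu hv mulr0 addr0.
apply/eqP; rewrite -normr_eq0 eq_le normr_ge0 andbT.
apply/ler_addgt0Pr => e e0; rewrite add0r.
have y0 : 0 < 1 + `|y| by rewrite ltr_wpDr.
have [z /= zy xz] := Sx _ (divr_gt0 e0 y0).
have -> : hdot x y = hdot (x - z) y by rewrite hdotBl zy subr0.
apply: le_trans (CauchySchwarz_hdot _ _) _.
apply: (@le_trans _ _ (e / (1 + `|y|) * (1 + `|y|))).
  by rewrite ler_pM ?lerDr// ltW.
by rewrite divfK// gt_eqF.
Qed.

(** The equaliser is the intersection of the orthogonal complements of the vectors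
    [adj S y - adj T y]. *)
Lemma closed_subspace_eq E F (S T : E -> F) : bounded_op S -> bounded_op T ->
  closed_subspace [set x | S x = T x].
Proof.
move=> bS bT.
have -> : [set x | S x = T x] =
    [set x | forall y, [set x | hdot x (adj S y - adj T y) = 0] x].
  apply/seteqP; split=> x /= h => [y|].
    by rewrite hdotBr -!adjP// h subrr.
  apply/eqP; rewrite -subr_eq0; apply/eqP/hdot_eq0.
  by rewrite hdotBl !adjP// -hdotBr h.
by apply: closed_subspace_bigcap => y; exact: closed_subspace_orthogonal.
Qed.

Lemma clspan_subspace E (A : set E) : closed_subspace (clspan A).
Proof.
split=> [S [] //|a x y Ax Ay S Scl AS|x Ax S Scl AS]; have [S0 Sl Sc] := Scl.
- by apply: Sl; [exact: Ax|exact: Ay].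
- by apply: Sc; apply: closure_subset Ax => y; exact.
Qed.

Lemma sub_clspan E (A : set E) : A `<=` clspan A.
Proof. by move=> x Ax S _; exact. Qed.

Lemma clspan_stable E (A : set E) (B : E -> E) : bounded_op B ->
  (forall x, A x -> clspan A (B x)) -> forall x, clspan A x -> clspan A (B x).
Proof.
move=> bB AB x Ax.
exact: (Ax _ (closed_subspace_preimage bB (clspan_subspace A))).
Qed.

Lemma total_eq E F (A : set E) (S T : E -> F) : clspan A = setT ->
  bounded_op S -> bounded_op T -> (forall x, A x -> S x = T x) ->
  forall x, S x = T x.
Proof.
move=> AT bS bT ST x; have : clspan A x by rewrite AT.
by move/(_ _ (closed_subspace_eq bS bT)); apply.
Qed.

Lemma bounded_comp E F (G : hilbertType R) (S : F -> G) (T : E -> F) :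
  bounded_op S -> bounded_op T -> bounded_op (S \o T).
Proof.
move=> [Sl [M SM]] [Tl [N TN]]; split=> [a x y|]; first by rewrite /= Tl Sl.
exists (`|M| * N) => x; rewrite -mulrA; apply: (@le_trans _ _ (`|M| * `|T x|)).
  apply: (@le_trans _ _ `|M * `|T x| |).
    by rewrite [leRHS]ger0_norm ?SM//; apply: le_trans (SM _).
  by rewrite normrM normr_id.
by rewrite ler_wpM2l.
Qed.

Lemma isometric_comp E F (G : hilbertType R) (S : F -> G) (T : E -> F) :
  isometric S -> isometric T -> isometric (S \o T).
Proof.
move=> [Sl Sn] [Tl Tn]; split=> [a x y|x]; first by rewrite /= Tl Sl.
by rewrite /= Sn Tn.
Qed.

(** |T^* y|^2 = <T T^* y, y> is at most |M| |T^* y| |y|; cancel |T^* y|. The bound is |M| because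
    [bounded_op] puts no sign on [M]. *)
Lemma adj_bounded E F (T : E -> F) : bounded_op T -> bounded_op (adj T).
Proof.
move=> bT; split; first exact: adj_linear.
have [Tl [M TM]] := bT; exists `|M| => y.
have [->|y0] := eqVneq (adj T y) 0; first by rewrite normr0 mulr_ge0.
have y1 : 0 < `|adj T y| by rewrite normr_gt0.
rewrite -(ler_pM2l y1) -expr2 -hdot_norm -adjP//.
rewrite -[leLHS]ger0_norm; last by rewrite adjP// hdot_ge0.
rewrite (le_trans (CauchySchwarz_hdot _ _))// mulrCA mulrA ler_wpM2r//.
apply: (@le_trans _ _ `|M * `|adj T y| |).
  by rewrite [leRHS]ger0_norm ?TM//; apply: le_trans (TM _).
by rewrite normrM normr_id.
Qed.

(** L L^* fixes the range of L, hence the total set [B], hence everything. *)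
Lemma isometric_total_surj E F (L : E -> F) (B : set F) : isometric L ->
  clspan B = setT -> (forall y, B y -> exists x, L x = y) ->
  forall y, exists x, L x = y.
Proof.
move=> Li BT BL y; exists (adj L y).
have bL := isometric_bounded Li.
have bid : bounded_op (@id F) by apply: isometric_bounded; split.
apply: (total_eq BT (bounded_comp bL (adj_bounded bL)) bid) => z /BL[x <-] /=.
by rewrite isometric_adjK.
Qed.

End ClosedSubspaces.

(** * Isometries from equal Gram matrices *)

Section Gram.
Variables (R : realType) (I : Type) (E F : hilbertType R).
Variables (a : I -> E) (b : I -> F).
Hypothesis a_total : clspan (range a) = setT.
Hypothesis ab : forall i j, hdot (a i) (a j) = hdot (b i) (b j).

(** This will be the graph of the isometry. *)
Let G : set (hsum E F) := clspan (range (fun i => (a i, b i) : hsum E F)).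

Let hsum_hdot (p q : hsum E F) : hdot p q = hdot p.1 q.1 + hdot p.2 q.2.
Proof. by []. Qed.

(** Turns the indefinite form <p.1, q.1> - <p.2, q.2> into an inner product with a fixed vector, so
    that its zero set in [p] is a closed subspace. *)
Let neg2 (q : hsum E F) : hsum E F := (q.1, - q.2).

Let hdot_neg2 (p q : hsum E F) : hdot p (neg2 q) = hdot p.1 q.1 - hdot p.2 q.2.
Proof. by rewrite hsum_hdot /= -scaleN1r hdotZr rmorphN rmorph1 mulN1r. Qed.

(** The form vanishes on pairs of generators and extends to the closed span one variable at a time,
    conjugate symmetry exchanging the slots. *)
Let G_gram p q : G p -> G q -> hdot p.1 q.1 = hdot p.2 q.2.
Proof.
move=> Gp Gq; apply/eqP; rewrite -subr_eq0 -hdot_neg2; apply/eqP.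
have h (r s : hsum E F) : hdot r (neg2 s) = (hdot s (neg2 r))^*.
  by rewrite !hdot_neg2 rmorphB /= -!hdot_conj.
apply: (Gp _ (closed_subspace_orthogonal (neg2 q))) => _ [i _ <-] /=.
rewrite h; apply/eqP; rewrite conjC_eq0; apply/eqP.
apply: (Gq _ (closed_subspace_orthogonal (neg2 _))) => _ [j _ <-] /=.
by rewrite hdot_neg2 /= ab subrr.
Qed.

(** The first projection of [G] is closed: by [G_gram], points of [G] whose first coordinates form a
    Cauchy sequence are themselves Cauchy. It contains the total family [a]. *)
Let G_dom x : exists y, G (x, y).
Proof.
have [G0 Gl Gc] := clspan_subspace (range (fun i => (a i, b i) : hsum E F)).
have : clspan (range a) x by rewrite a_total.
move/(_ [set x | exists y, G (x, y)]); apply; last first.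
  move=> _ [i _ <-]; exists (b i); apply: sub_clspan.
  by exists i.
split=> [|c u v [y uy] [z vz]|{}x /closureNP Sx].
- by exists 0; exact: G0.
- by exists (c *: y + z); exact: (Gl c _ _ uy vz).
have /choice[u uP] : forall n : nat, exists p : hsum E F,
    G p /\ `|x - p.1| < n.+1%:R^-1.
  move=> n; have [|z [y zy] xz] := Sx n.+1%:R^-1; first by rewrite invr_gt0 ltr0n.
  by exists (z, y).
have le_d m n : (n <= m)%N -> (m.+1%:R^-1 : R[i]) <= n.+1%:R^-1.
  by move=> nm'; rewrite lef_pV2 ?posrE ?ltr0n// ler_nat.
have GB p q : G p -> G q -> G (p - q).
  by move=> Gp Gq; rewrite -[p - q]addrC -scaleN1r; exact: Gl.
have uc : cvgn u.
  apply: hilbert_complete => e e0.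
  (* The squared norm in the sum consists of two equal terms, each to be at most e / 2; the triangle
     inequality through [x] halves the square root once more. *)
  have e20 : 0 < sqrtC (e / 2) / 2 by rewrite divr_gt0// sqrtC_gt0 divr_gt0.
  have [N Ne] := complex_archi e20; exists N => m n Nm Nn.
  have mn := GB _ _ (uP m).1 (uP n).1.
  rewrite hsum_hdot -(G_gram mn mn) -[hdot _ _]/(hdot ((u m).1 - (u n).1) _).
  suff h : hdot ((u m).1 - (u n).1) ((u m).1 - (u n).1) <= e / 2.
    by rewrite (splitr e) lerD.
  rewrite hdot_norm -[leRHS]sqrtCK ler_sqr ?nnegrE ?sqrtC_ge0 ?divr_ge0 ?(ltW e0)//.
  rewrite -(subrKA x) (splitr (sqrtC _)) (le_trans (ler_normD _ _))// lerD//.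
    rewrite distrC (le_trans (ltW (uP m).2))// (le_trans _ (ltW Ne))//; exact: le_d.
  rewrite (le_trans (ltW (uP n).2))// (le_trans _ (ltW Ne))//; exact: le_d.
have Gp : G (limn u).
  by apply: (closed_cvg _ Gc _ _ uc); apply: nearW => n; exact: (uP n).1.
exists (limn u).2; suff -> : x = (limn u).1 by rewrite -surjective_pairing.
apply/eqP; rewrite -subr_eq0 -normr_eq0 eq_le normr_ge0 andbT.
apply/ler_addgt0Pr => e e0; rewrite add0r.
have e20 : 0 < e / 2 by rewrite divr_gt0.
have [N Ne] := complex_archi e20.
have /cvgrPdist_le/(_ _ e20)[N' _ N'e] := uc.
pose n := maxn N N'.
rewrite -(subrKA (u n).1) (splitr e) (le_trans (ler_normD _ _))// lerD//.
  rewrite (le_trans (ltW (uP n).2))// (le_trans _ (ltW Ne))//; apply: le_d.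
  exact: leq_maxl.
rewrite distrC; apply: le_trans (N'e n (leq_maxr _ _)).
by rewrite -ler_sqr ?nnegrE// -!hdot_norm hsum_hdot /= lerDl hdot_ge0.
Qed.

Lemma gram_isometry : exists2 L : E -> F, isometric L & forall i, L (a i) = b i.
Proof.
have [G0 Gl Gc] := clspan_subspace (range (fun i => (a i, b i) : hsum E F)).
(* [G] is single-valued: a difference (0, y - z) in it has |y - z| = |0| by [G_gram]. *)
have Gfun x y z : G (x, y) -> G (x, z) -> y = z.
  move=> Gy Gz; have := Gl (-1) _ _ Gy Gz; rewrite scaleN1r => h.
  have := G_gram h h; rewrite /= addNr hdot0l => /esym/hdot_eq0/eqP.
  by rewrite addrC subr_eq0 => /eqP.
have /choice[L LG] := G_dom.
exists L; last first.
  by move=> i; apply: (Gfun (a i)) => //; apply: sub_clspan; exists i.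
apply: hdot_isometric => [c x y|x]; last by have := G_gram (LG x) (LG x).
by apply: (Gfun (c *: x + y)) => //; exact: (Gl c _ _ (LG x) (LG y)).
Qed.

End Gram.

(* Conversion between two distinct values of [H2mk] unfolds [insubd] and does not
   terminate in practice; locking [H2mk] keeps rewriting usable. *)
Definition H2of (R : realType) (F : hilbertType R) : (nat -> F) -> H2 F :=
  locked (@H2mk R F).

Lemma H2of_mk (R : realType) (F : hilbertType R) (a : nat -> F) : H2mk a = H2of a.
Proof. by rewrite /H2of -lock. Qed.

Lemma H2ofE (R : realType) (F : hilbertType R) (a : nat -> F) :
  square_summable a -> coef (H2of a) = a.
Proof. by rewrite -H2of_mk; exact: H2mkE. Qed.

(** * Hardy space: monomials, multiplications and their adjoints *)

Section HardySpace.
Variables (R : realType) (F : hilbertType R).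
Implicit Types (f g : H2 F) (x y : F).

Lemma H2_ext f g : (forall n, f n = g n) -> f = g.
Proof. by move=> fg; apply/val_inj/funext. Qed.

Lemma H2_hdot_cvg f g :
  series (fun n => hdot (f n) (g n) : R[i]^o) @ \oo --> (hdot f g : R[i]^o).
Proof. exact (hdot_series_cvg (H2P f) (H2P g)). Qed.

(** Serves the observability operator and the Fourier map alike; in both, [l] is what is missing for
    them to be isometric. *)
Lemma H2_hdot_telescope f g (c : nat -> R[i]^o) (l : R[i]^o) :
  (forall n, hdot (f n) (g n) = c n - c n.+1) -> c @ \oo --> l ->
  hdot f g = c 0%N - l.
Proof.
move=> fgc cl; suff h : series (fun n => hdot (f n) (g n) : R[i]^o) @ \oo --> (c 0%N - l : R[i]^o).
  exact (@norm_cvg_unique _ R[i]^o _ _ _ _ (@H2_hdot_cvg f g) h).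
have -> : series (fun n => hdot (f n) (g n) : R[i]^o) = (fun n => c 0%N - c n).
  apply/funext; elim=> [|n IH]; first by rewrite /series /= big_nil subrr.
  rewrite /series /= big_nat_recr//= fgc.
  by have := IH; rewrite /series /= => ->; rewrite addrA subrK.
exact (@cvgB _ R[i]^o _ _ _ _ _ _ _ (cvg_cst _) cl).
Qed.

Lemma telescope_square_summable (a : nat -> F) (c : nat -> R[i]) :
  (forall n, `|a n| ^+ 2 = c n - c n.+1) -> (forall n, 0 <= c n) ->
  square_summable a.
Proof.
move=> ac c0; apply/square_summableP; exists (c 0%N) => n.
suff -> : \sum_(0 <= k < n) `|a k| ^+ 2 = c 0%N - c n by rewrite gerBl.
elim: n => [|n IH]; first by rewrite big_nil subrr.
by rewrite big_nat_recr//= IH ac addrA subrK.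
Qed.

Lemma H2_sum_le f n : \sum_(0 <= k < n) `|f k| ^+ 2 <= `|f| ^+ 2.
Proof.
rewrite -hdot_norm H2_hdotE.
under [X in series X]funext do rewrite hdot_norm.
by apply: (@series_le_lim _ _ n _ (H2P f)) => k; rewrite exprn_ge0.
Qed.

Lemma H2_norm_le f M : (forall n, \sum_(0 <= k < n) `|f k| ^+ 2 <= M) ->
  `|f| ^+ 2 <= M.
Proof.
move=> fM; rewrite -hdot_norm; apply: (complex_lim_le _ (@H2_hdot_cvg f f)) => n.
apply: le_trans (fM n); rewrite /series /=.
by apply: ler_sum => k _; rewrite hdot_norm.
Qed.

Lemma finite_square_summable (a : nat -> F) N :
  (forall n, (N <= n)%N -> a n = 0) -> square_summable a.
Proof.
move=> aN; apply/square_summableP; exists (\sum_(0 <= k < N) `|a k| ^+ 2) => n.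
have [nN|Nn] := leqP n N.
  rewrite (@big_cat_nat _ _ _ n 0 N)//= lerDl.
  by apply: sumr_ge0 => k _; rewrite exprn_ge0.
rewrite (@big_cat_nat _ _ _ N 0 n)//=; last exact: ltnW.
rewrite [X in _ + X]big1_seq ?addr0// => k.
by rewrite mem_index_iota => /andP[_ /andP[Nk _]]; rewrite aN// normr0 expr0n.
Qed.

Lemma H2_hdot_finite f g N : (forall n, (N <= n)%N -> f n = 0) ->
  hdot f g = \sum_(0 <= k < N) hdot (f k) (g k).
Proof.
move=> fN; suff h : series (fun n => hdot (f n) (g n) : R[i]^o) @ \oo -->
    (\sum_(0 <= k < N) hdot (f k) (g k) : R[i]^o).
  exact (@norm_cvg_unique _ R[i]^o _ _ _ _ (@H2_hdot_cvg f g) h).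
rewrite -(cvg_shiftn N).
have -> : (fun n => series (fun n => hdot (f n) (g n) : R[i]^o) (n + N)%N) =
    fun=> (\sum_(0 <= k < N) hdot (f k) (g k) : R[i]^o).
  apply/funext => n.
  rewrite /series /= (@big_cat_nat _ _ _ N 0 (n + N)) ?leq_addl//=.
  rewrite [X in _ + X]big1_seq ?addr0// => k.
  by rewrite mem_index_iota => /andP[_ /andP[Nk _]]; rewrite fN// hdot0l.
exact: cvg_cst.
Qed.

Definition H2mono (k : nat) x : H2 F := H2of (fun n => if n == k then x else 0).

Lemma H2monoE k x n : H2mono k x n = if n == k then x else 0.
Proof.
rewrite /H2mono H2ofE//; apply: (@finite_square_summable _ k.+1) => m km.
by rewrite gtn_eqF.
Qed.

Lemma H2mono_hdot k x f : hdot (H2mono k x) f = hdot x (f k).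
Proof.
rewrite (@H2_hdot_finite _ _ k.+1) => [|m km].
  rewrite big_nat_recr//= big1_seq ?add0r => [|m]; first by rewrite H2monoE eqxx.
  by rewrite mem_index_iota H2monoE => /andP[_ /ltn_eqF ->]; rewrite hdot0l.
by rewrite H2monoE gtn_eqF.
Qed.

Lemma H2mono_isometric k : isometric (H2mono k).
Proof.
apply: hdot_isometric => [a x y|x].
  apply: H2_ext => n; rewrite -[RHS]/(a *: H2mono k x n + H2mono k y n).
  rewrite !H2monoE; case: (n == k); first by [].
  by rewrite scaler0 addr0.
by rewrite H2mono_hdot H2monoE eqxx.
Qed.

Let trunc f N : H2 F := H2of (fun n => if (n < N)%N then f n else 0).

Let truncE f N n : trunc f N n = if (n < N)%N then f n else 0.
Proof.
rewrite /trunc H2ofE//; apply: (@finite_square_summable _ N) => m Nm.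
by rewrite ltnNge Nm.
Qed.

Let trunc_hdot f g N : hdot (trunc f N) g = \sum_(0 <= k < N) hdot (f k) (g k).
Proof.
rewrite (@H2_hdot_finite _ _ N) => [|m Nm]; last by rewrite truncE ltnNge Nm.
by apply: eq_big_nat => k /andP[_ kN]; rewrite truncE kN.
Qed.

Let trunc_dist f N :
  `|f - trunc f N| ^+ 2 = `|f| ^+ 2 - \sum_(0 <= k < N) `|f k| ^+ 2.
Proof.
rewrite -!hdot_norm hdotBl !hdotBr (hdot_conj f (trunc _ _)) !trunc_hdot.
have -> : \sum_(0 <= k < N) hdot (f k) (trunc f N k) =
    \sum_(0 <= k < N) `|f k| ^+ 2.
  by apply: eq_big_nat => k /andP[_ kN]; rewrite truncE kN hdot_norm.
have -> : \sum_(0 <= k < N) hdot (f k) (f k) = \sum_(0 <= k < N) `|f k| ^+ 2.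
  by apply: eq_bigr => k _; rewrite hdot_norm.
rewrite subrr subr0; congr (_ - _); apply: conj_Creal.
by rewrite ger0_real// sumr_ge0// => k _; rewrite exprn_ge0.
Qed.

(** Taylor partial sums converge in norm, the squared distance being the tail of the norm series. *)
Lemma H2_closed_mono (S : set (H2 F)) f : closed_subspace S ->
  (forall n, S (H2mono n (f n))) -> S f.
Proof.
move=> [S0 Sl Sc] Sf.
have St N : S (trunc f N).
  elim: N => [|N IH].
    suff -> : trunc f 0 = 0 by [].
    by apply: H2_ext => n; rewrite truncE.
  suff -> : trunc f N.+1 = 1 *: H2mono N (f N) + trunc f N by exact: Sl.
  apply: H2_ext => n; rewrite -[RHS]/(1 *: H2mono N (f N) n + trunc f N n).
  rewrite scale1r !truncE H2monoE ltnS leq_eqVlt.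
  by have [->|] := eqVneq n N; rewrite ?ltnn ?addr0 ?add0r.
apply: Sc; apply/closureNP => e e0.
have h : (fun N => `|f| ^+ 2 - \sum_(0 <= k < N) `|f k| ^+ 2 : R[i]^o) @ \oo
    --> (0 : R[i]^o).
  rewrite -{2}(subrr (`|f| ^+ 2)).
  apply: (@cvgB _ R[i]^o _ _ _ _ _ _ _ (cvg_cst _)).
  have := @H2_hdot_cvg f f; rewrite hdot_norm.
  by under [X in series X]funext do rewrite hdot_norm.
have e20 : 0 < (e / 2) ^+ 2 by rewrite exprn_gt0// divr_gt0.
have [N _ /(_ N (leqnn N)) /=] := (@cvgrPdist_le _ R[i]^o _ _ _ _ _).1 h _ e20.
rewrite sub0r normrN -trunc_dist => Ne; exists (trunc f N) => //.
apply: (@le_lt_trans _ _ (e / 2)); last first.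
  by rewrite ltr_pdivrMr// ltr_pMr// ltr1n.
rewrite -ler_sqr ?nnegrE ?divr_ge0 ?(ltW e0)//.
by apply: le_trans Ne; rewrite ger0_norm// exprn_ge0.
Qed.

Definition H2lmul (A B : F -> F) f : H2 F :=
  H2of (fun n => A (f n) + (if n is m.+1 then B (f m) else 0)).

Lemma H2mul_lmul (A B : F -> F) : H2mul A B = H2lmul A B.
Proof. by apply/funext => f; exact: H2of_mk. Qed.

Lemma H2lmulE (A B : F -> F) f n : bounded_op A -> bounded_op B ->
  H2lmul A B f n = A (f n) + (if n is m.+1 then B (f m) else 0).
Proof. by rewrite -H2mul_lmul; exact: H2mulE. Qed.

Lemma H2lmul_linear (A B : F -> F) : bounded_op A -> bounded_op B ->
  linear (H2lmul A B).
Proof.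
move=> bA bB c f g; apply: H2_ext => n.
rewrite -[RHS]/(c *: H2lmul A B f n + H2lmul A B g n) !H2lmulE//.
rewrite -[(c *: f + g) n]/(c *: f n + g n) bA.1 scalerDr addrACA.
congr (_ + _); case: n => [|n]; first by rewrite scaler0 addr0.
by rewrite -[(c *: f + g) n]/(c *: f n + g n) bB.1.
Qed.

(** The hypotheses say that A and B have orthogonal ranges and that A^* A + B^* B = 1, which makes A
    + zB isometric at each |z| = 1. *)
Lemma H2lmul_isometric (A B : F -> F) : bounded_op A -> bounded_op B ->
  (forall x y, `|A x + B y| ^+ 2 = `|A x| ^+ 2 + `|B y| ^+ 2) ->
  (forall x, `|A x| ^+ 2 + `|B x| ^+ 2 = `|x| ^+ 2) ->
  isometric (H2lmul A B).
Proof.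
move=> bA bB AB AB1; split=> [|f]; first exact: H2lmul_linear.
(* Of the last coefficient [f n] only the A-half has arrived by degree n. The sum thus lies between
   two partial sums of |f|^2, which gives both inequalities. *)
have Sr n : \sum_(0 <= k < n.+1) `|H2lmul A B f k| ^+ 2 =
    \sum_(0 <= k < n) `|f k| ^+ 2 + `|A (f n)| ^+ 2.
  elim: n => [|n IH].
    by rewrite big_nat1 big_nil add0r H2lmulE// addr0.
  rewrite big_nat_recr//= IH [in RHS]big_nat_recr//= H2lmulE// AB.
  by rewrite -(AB1 (f n)) [`|A (f n.+1)| ^+ 2 + _]addrC !addrA.
apply/eqP; rewrite -(@eqrXn2 _ 2)// eq_le; apply/andP; split.
  apply: H2_norm_le => -[|n]; first by rewrite big_nil exprn_ge0.
  rewrite Sr; apply: le_trans (H2_sum_le f n.+1).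
  by rewrite big_nat_recr//= lerD2l -(AB1 (f n)) lerDl exprn_ge0.
apply: H2_norm_le => n; apply: le_trans (H2_sum_le _ n.+1).
by rewrite Sr lerDl exprn_ge0.
Qed.

Lemma H2lmul_mono (A B : F -> F) k x : bounded_op A -> bounded_op B ->
  H2lmul A B (H2mono k x) = H2mono k (A x) + H2mono k.+1 (B x).
Proof.
move=> bA bB; have A0 := linear_map0 bA.1; have B0 := linear_map0 bB.1.
apply: H2_ext => n; rewrite -[RHS]/(H2mono k (A x) n + H2mono k.+1 (B x) n).
rewrite H2lmulE// !H2monoE; congr (_ + _); first by case: eqP.
by case: n => // n; rewrite H2monoE eqSS; case: eqP.
Qed.

Lemma adj_H2lmul (A B : F -> F) f n : bounded_op A -> bounded_op B ->
  bounded_op (H2lmul A B) ->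
  adj (H2lmul A B) f n = adj A (f n) + adj B (f n.+1).
Proof.
move=> bA bB bM; apply: hdot_inj => x.
rewrite -H2mono_hdot -adjP// H2lmul_mono// hdotDl !H2mono_hdot.
by rewrite hdotDr !adjP.
Qed.

End HardySpace.

Section HardyMap.
Variables (R : realType) (F E : hilbertType R) (L : F -> E).
Implicit Types f : H2 F.

Definition H2lmap f : H2 E :=
  H2of (fun n => L (f n)).

Lemma H2map_lmap : H2map L = H2lmap.
Proof. by apply/funext => f; exact: H2of_mk. Qed.

Lemma H2lmapE f n : bounded_op L ->
  H2lmap f n = L (f n).
Proof. by rewrite -H2map_lmap; exact: H2mapE. Qed.

Lemma H2lmap_isometric : isometric L ->
  isometric (H2lmap).
Proof.
move=> Li; have bL := isometric_bounded Li; split=> [c f g|f].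
  apply: H2_ext => n; rewrite -[RHS]/(c *: H2lmap f n + H2lmap g n) !H2lmapE//.
  exact: Li.1.
have h : hdot (H2lmap f) (H2lmap f) = hdot f f.
  have e : (fun n => hdot (H2lmap f n) (H2lmap f n) : R[i]^o) =
      (fun n => hdot (f n) (f n)).
    by apply/funext => n; rewrite H2lmapE// isometric_hdot.
  by rewrite [LHS]H2_hdotE e.
by apply/eqP; rewrite -(@eqrXn2 _ 2)// -!hdot_norm h.
Qed.

End HardyMap.

(** * Iterates, positive roots, defect and asymptotic operators *)

Lemma csub_hdot (R : realType) (H : hilbertType R) (S : csubspace H)
  (x y : csub S) : hdot x y = hdot (val x) (val y).
Proof. by []. Qed.

Lemma csub_val_isometric (R : realType) (H : hilbertType R) (S : csubspace H) :
  isometric (val : csub S -> H).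
Proof. by apply: hdot_isometric => // a x y; rewrite linearP. Qed.

Lemma iter_linear (R : realType) (E : hilbertType R) (T : E -> E) n :
  linear T -> linear (iter n T).
Proof. by move=> Tl a x y; elim: n => //= n ->; rewrite Tl. Qed.

Lemma hdot_iter_adj (R : realType) (E : hilbertType R) (T : E -> E) n x y :
  bounded_op T -> hdot (iter n T x) y = hdot x (iter n (adj T) y).
Proof. by move=> bT; elim: n y => //= n IH y; rewrite adjP// IH -iterSr. Qed.

Lemma iter_commute (X : Type) (f g : X -> X) n x :
  (forall x, f (g x) = g (f x)) -> iter n f (g x) = g (iter n f x).
Proof. by move=> fg; elim: n => //= n ->. Qed.

Lemma iter_comp (X : Type) (f g : X -> X) n x :
  (forall x, f (g x) = g (f x)) -> iter n (f \o g) x = iter n f (iter n g x).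
Proof. by move=> fg; elim: n => //= n ->; rewrite (iter_commute _ _ fg). Qed.

Lemma iter_iter_commute (X : Type) (f g : X -> X) m n x :
  (forall x, f (g x) = g (f x)) ->
  iter m f (iter n g x) = iter n g (iter m f x).
Proof. by move=> fg; elim: n => //= n <-; rewrite (iter_commute _ _ fg). Qed.

Lemma iter_cancel (X : Type) (f g : X -> X) m n x : cancel f g -> (n <= m)%N ->
  iter m g (iter n f x) = iter (m - n) g x.
Proof.
move=> fK; elim: n m => [m _|n IH [//|m] nm]; first by rewrite subn0.
by rewrite iterSr /= fK IH.
Qed.

Section PositiveRoot.
Variables (R : realType) (H : hilbertType R) (A : H -> H) (B : {linear H -> H}).
Hypothesis AB : psqrt A B.

(* Positivity makes [<B z, z>] real; compare [z = x + y] and [z = x + i y]. *)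
Lemma psqrt_selfadjoint x y : hdot (B x) y = hdot x (B y).
Proof.
have real z : (hdot (B z) z)^* = hdot (B z) z by rewrite conj_Creal// ger0_real// AB.1.
have h1 := real (x + y); have h2 := real (x + 'i *: y).
move: h1 h2; rewrite !linearD !linearZ /= !(hdotDl, hdotDr, hdotZl, hdotZr).
rewrite !(rmorphD, rmorphM) /= !conjCK conjCi !real.
rewrite (hdot_conj x (B y)).
set a := hdot (B x) x; set b := hdot (B y) y.
set c := hdot (B x) y; set d := hdot (B y) x => h1 h2.
have i2 : ('i * 'i : R[i]) = -1 by rewrite -expr2 sqrCi.
have i0 : ('i : R[i]) != 0 by rewrite neq0Ci.
set i := 'i in h2 i2 i0; set c' := c^*; set d' := d^*.
rewrite -/c' -/d' in h1 h2.
have e : i * 2 * (c - d') =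
    i * ((a + c + (d + b)) - (a + c' + (d' + b))) +
    ((a + i * c' + (- i * d' + - i * (i * b))) -
     (a + - i * c + (i * d + i * (- i * b)))) by ring.
apply/eqP; rewrite -subr_eq0 -[_ == 0]orFb.
have <- : (i * 2 == 0) = false by rewrite mulf_eq0 (negbTE i0) pnatr_eq0.
by rewrite -mulf_eq0 e h1 h2 !subrr mulr0 addr0.
Qed.

Lemma psqrt_hdot x y : hdot (B x) (B y) = hdot (A x) y.
Proof. by rewrite -psqrt_selfadjoint AB.2. Qed.

End PositiveRoot.

Section ClosedRange.
Variables (R : realType) (H : hilbertType R) (D : {linear H -> H}).

Lemma clran_op_linear : linear (clran_op D).
Proof.
by move=> a x y; apply: val_inj; rewrite /= linearP.
Qed.

Lemma clran_op_total : clspan (range (clran_op D)) = setT.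
Proof.
apply/seteqP; split=> // x _ S [_ _ Sc] DS; apply: Sc.
apply/closureNP => e e0; have := csub_mem x; rewrite inE => /closureNP /(_ e e0).
move=> [_ [h _ <-] xh]; exists (clran_op D h); first by apply: DS; exists h.
by rewrite -(csub_val_isometric _).2.
Qed.

End ClosedRange.

Section DefectAndAsymptoticRoot.
Variables (R : realType) (H : hilbertType R) (T : H -> H) (D Q : {linear H -> H}).
Hypotheses (hT : contractive T) (hD : defect_star T D) (hQ : asymptotic_root T Q).

Let bT : bounded_op T. Proof. exact: contractive_bounded. Qed.

(** Along the orbit of [adj T] these differences telescope. *)
Lemma defect_hdot h k : hdot (D h) (D k) = hdot h k - hdot (adj T h) (adj T k).
Proof. by rewrite (psqrt_hdot hD) hdotBl adjP. Qed.

Lemma asymptotic_root_cvg h k :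
  (fun n => hdot (iter n (adj T) h) (iter n (adj T) k) : R[i]^o) @ \oo -->
  (hdot (Q h) (Q k) : R[i]^o).
Proof.
have [A Ah AQ] := hQ; rewrite (psqrt_hdot AQ).
have -> : (fun n => hdot (iter n (adj T) h) (iter n (adj T) k) : R[i]^o) =
    (fun n => hdot (iter n T (iter n (adj T) h)) k).
  by apply/funext => n; rewrite [RHS]hdot_iter_adj.
exact: cvg_hdotl.
Qed.

Lemma observability_summable h :
  square_summable (fun n => clran_op D (iter n (adj T) h)).
Proof.
apply: (@telescope_square_summable _ _ _
  (fun n => hdot (iter n (adj T) h) (iter n (adj T) h))) => n.
  by rewrite -hdot_norm csub_hdot /= defect_hdot.
exact: hdot_ge0.
Qed.

Definition lobservability (h : H) : H2 (csub (clran D)) :=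
  H2of (fun n => clran_op D (iter n (adj T) h)).

Lemma observability_lobservability : observability D T = lobservability.
Proof. by apply/funext => h; exact: H2of_mk. Qed.

Lemma lobservabilityE h n :
  lobservability h n = clran_op D (iter n (adj T) h).
Proof. by rewrite /lobservability H2ofE//; exact: observability_summable. Qed.

(** This is why pairing the observability operator with [Q] embeds H isometrically. *)
Lemma lobservability_hdot h k :
  hdot (lobservability h) (lobservability k) =
  hdot h k - hdot (Q h) (Q k).
Proof.
apply: (H2_hdot_telescope (c := fun n => hdot (iter n (adj T) h) (iter n (adj T) k))).
  by move=> n; rewrite !lobservabilityE csub_hdot /= defect_hdot.
exact: asymptotic_root_cvg.
Qed.

Lemma lobservability_linear : linear (lobservability).
Proof.
move=> a x y; apply: H2_ext => n; rewrite -[RHS]/(a *: lobservability x n + lobservability y n).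
rewrite !lobservabilityE (iter_linear _ (adj_linear bT)).
exact: clran_op_linear.
Qed.

End DefectAndAsymptoticRoot.

(** * Orthogonal projections and the two multiplications *)

Section OrthogonalProjection.
Variables (R : realType) (F : hilbertType R) (P : F -> F).
Hypothesis hP : orthoproj P.

Lemma orthoproj_hdot x y : hdot (P x) (P y) = hdot (P x) y.
Proof. by case: hP => Pl PP Ps; rewrite -Ps PP. Qed.

Lemma orthoproj_orthogonal x y : hdot (P x) (y - P y) = 0.
Proof. by rewrite hdotBr orthoproj_hdot subrr. Qed.

Lemma orthoproj_orthogonalC x y : hdot (y - P y) (P x) = 0.
Proof. by rewrite hdot_conj orthoproj_orthogonal rmorph0. Qed.

Lemma orthoproj_compl : orthoproj (fun x => x - P x).
Proof.
case: hP => Pl PP Ps; split=> [a x y|x|x y].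
- by rewrite Pl opprD addrACA scalerBr.
- by rewrite (linear_mapB Pl) PP subrr subr0.
- by rewrite hdotBl hdotBr Ps.
Qed.

Lemma pythagoras (x y : F) : hdot x y = 0 -> `|x + y| ^+ 2 = `|x| ^+ 2 + `|y| ^+ 2.
Proof.
move=> xy; rewrite -!hdot_norm hdotDl !hdotDr xy (hdot_conj y x) xy rmorph0.
by rewrite addr0 add0r.
Qed.

Lemma orthoproj_norm x : `|x - P x| ^+ 2 + `|P x| ^+ 2 = `|x| ^+ 2.
Proof. by rewrite -pythagoras ?subrK// orthoproj_orthogonalC. Qed.

Lemma orthoproj_contractive : contractive P.
Proof.
case: hP => Pl PP Ps; split=> // x; rewrite -ler_sqr ?nnegrE//.
by rewrite -(orthoproj_norm x) lerDr exprn_ge0.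
Qed.

End OrthogonalProjection.

Lemma unitary_adj_unitary (R : realType) (E F : hilbertType R) (U : E -> F) :
  unitary U -> unitary (adj U).
Proof.
move=> hU; have bU := isometric_bounded hU.1; split.
  split=> [|y]; first exact: adj_linear.
  by rewrite -hU.1.2 unitary_adjK.
by move=> x; exists (U x); rewrite isometric_adjK//; exact: hU.1.
Qed.

Lemma adj_adj (R : realType) (E F : hilbertType R) (T : E -> F) :
  bounded_op T -> adj (adj T) = T.
Proof. by move=> bT; apply/funext => x; apply: adj_unique => y; exact: adjPr. Qed.

Section AndoMultiplication.
Variables (R : realType) (F : hilbertType R) (P U : F -> F).
Hypotheses (hP : orthoproj P) (hU : unitary U).

Let A1 x := adj U (x - P x).
Let B1 x := adj U (P x).
Let A2 x := P (U x).
Let B2 x := U x - P (U x).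

Let hP' := orthoproj_compl hP.
Let hU' : unitary (adj U) := unitary_adj_unitary hU.
Let bP := contractive_bounded (orthoproj_contractive hP).
Let bP' := contractive_bounded (orthoproj_contractive hP').
Let bU := isometric_bounded hU.1.
Let bU' := isometric_bounded hU'.1.
Let bA1 : bounded_op A1 := bounded_comp bU' bP'.
Let bB1 : bounded_op B1 := bounded_comp bU' bP.
Let bA2 : bounded_op A2 := bounded_comp bP bU.
Let bB2 : bounded_op B2 := bounded_comp bP' bU.

Definition lando_mul1 : H2 F -> H2 F := H2lmul A1 B1.
Definition lando_mul2 : H2 F -> H2 F := H2lmul A2 B2.

Lemma ando_mul1_lando : ando_mul1 P U = lando_mul1.
Proof. exact: H2mul_lmul. Qed.

Lemma ando_mul2_lando : ando_mul2 P U = lando_mul2.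
Proof. exact: H2mul_lmul. Qed.

Lemma lando_mul1E f n :
  lando_mul1 f n = adj U (f n - P (f n)) +
    (if n is m.+1 then adj U (P (f m)) else 0).
Proof. exact: H2lmulE. Qed.

Lemma lando_mul2E f n :
  lando_mul2 f n = P (U (f n)) + (if n is m.+1 then U (f m) - P (U (f m)) else 0).
Proof. exact: H2lmulE. Qed.

Lemma lando_mul1_isometric : isometric lando_mul1.
Proof.
apply: H2lmul_isometric => // x => [y|].
  apply: pythagoras; rewrite (isometric_hdot _ _ hU'.1).
  exact: orthoproj_orthogonalC.
by rewrite !hU'.1.2 orthoproj_norm.
Qed.

Lemma lando_mul2_isometric : isometric lando_mul2.
Proof.
apply: H2lmul_isometric => // x => [y|].
  exact: (pythagoras (orthoproj_orthogonal hP (U x) (U y))).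
by rewrite addrC /B2 /A2 orthoproj_norm// hU.1.2.
Qed.

(** In (P^perp + zP)(P + zP^perp) the terms of degree 0 and 2 vanish and the middle one is z, so the
    product is the shift. The opposite order gives the shift too, whence commutation. *)
Lemma lando_mul12E f n :
  lando_mul1 (lando_mul2 f) n = if n is m.+1 then f m else 0.
Proof.
have [Pl PP _] := hP; have UB := linear_mapB bU.1.
have PB := linear_mapB Pl; have PD := linear_mapD Pl.
have UD := linear_mapD bU'.1; have U0 := linear_map0 bU'.1.
rewrite lando_mul1E lando_mul2E; case: n => [|n].
  by rewrite !addr0 PP subrr U0.
have Pc x : P (x - P x) = 0 by rewrite PB PP subrr.
rewrite lando_mul2E -UD [in X in _ - X]PD PP Pc addr0 [P (_ + _)]PD PP.
have -> : P (if n is m.+1 then U (f m) - P (U (f m)) else 0) = 0.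
  by case: n => [|n]; rewrite ?Pc// (linear_map0 Pl).
by rewrite addr0 [P _ + _]addrC addrK subrK isometric_adjK//; exact: hU.1.
Qed.

Lemma lando_mul21E f n :
  lando_mul2 (lando_mul1 f) n = if n is m.+1 then f m else 0.
Proof.
have [Pl PP _] := hP; have UK := unitary_adjK hU.
have PB := linear_mapB Pl; have PD := linear_mapD Pl.
have UD := linear_mapD bU.1; have U0 := linear_map0 bU.1.
rewrite lando_mul2E lando_mul1E; case: n => [|n].
  by rewrite !addr0 UK PB PP subrr.
rewrite lando_mul1E !UD !UK.
have PU0 : P (U (if n is m.+1 then adj U (P (f m)) else 0)) =
    U (if n is m.+1 then adj U (P (f m)) else 0).
  by case: n => [|n]; rewrite ?UK ?PP// U0 (linear_map0 Pl).
have Pc x : P (x - P x) = 0 by rewrite PB PP subrr.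
have PcD x y : P (x - P x + y) = P y by rewrite PD Pc add0r.
by rewrite !PcD PU0 PP addrK addrC subrK.

Qed.

Lemma lando_mul_commute f : lando_mul1 (lando_mul2 f) = lando_mul2 (lando_mul1 f).
Proof. by apply: H2_ext => n; rewrite lando_mul12E lando_mul21E. Qed.

Lemma lando_mul12_mono k x :
  lando_mul1 (lando_mul2 (H2mono k x)) = H2mono k.+1 x.
Proof.
apply: H2_ext => n; rewrite lando_mul12E H2monoE.
by case: n => // n; rewrite H2monoE eqSS.
Qed.

Lemma adj_lando_mul1E f n :
  adj lando_mul1 f n = (U (f n) - P (U (f n))) + P (U (f n.+1)).
Proof.
have [Pl PP Ps] := hP; have [_ _ Ps'] := hP'.
rewrite adj_H2lmul//; last exact: isometric_bounded lando_mul1_isometric.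
congr (_ + _); apply: adj_unique => x.
  by rewrite /A1 adjPr// Ps'.
by rewrite /B1 adjPr// Ps.
Qed.

Lemma adj_lando_mul2E f n :
  adj lando_mul2 f n = adj U (P (f n)) + adj U (f n.+1 - P (f n.+1)).
Proof.
have [Pl PP Ps] := hP; have [_ _ Ps'] := hP'.
rewrite adj_H2lmul//; last exact: isometric_bounded lando_mul2_isometric.
congr (_ + _); apply: adj_unique => x.
  by rewrite /A2 Ps adjP.
by rewrite /B2 Ps' adjP.
Qed.

End AndoMultiplication.

(** * Adjoints along a lift *)

Section Intertwining.
Variables (R : realType) (H K : hilbertType R).
Variables (T1 T2 : H -> H) (V1 V2 : K -> K) (Pi : H -> K).
Hypotheses (hT1 : contractive T1) (hT2 : contractive T2).
Hypotheses (hV1 : isometric V1) (hV2 : isometric V2).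
Hypothesis hT12 : forall h, T1 (T2 h) = T2 (T1 h).
Hypothesis hV12 : forall x, V1 (V2 x) = V2 (V1 x).
Hypothesis hPi1 : forall h, adj V1 (Pi h) = Pi (adj T1 h).
Hypothesis hPi2 : forall h, adj V2 (Pi h) = Pi (adj T2 h).

Let bT1 := contractive_bounded hT1.
Let bT2 := contractive_bounded hT2.
Let bV1 := isometric_bounded hV1.
Let bV2 := isometric_bounded hV2.

Lemma adj_commute (E : hilbertType R) (S T : E -> E) :
  bounded_op S -> bounded_op T -> (forall x, S (T x) = T (S x)) ->
  forall x, adj S (adj T x) = adj T (adj S x).
Proof.
move=> bS bT ST x; apply: hdot_inj => y.
by rewrite -!adjP// ST.
Qed.

Lemma adj_product_lift h : adj (V1 \o V2) (Pi h) = Pi (adj (T1 \o T2) h).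
Proof. by rewrite (adj_comp bV1 bV2) (adj_comp bT1 bT2) /= hPi1 hPi2. Qed.

(** The adjoints first cancel the isometries, and those left over pass through [Pi]. As [Pi] is not
    assumed isometric, the lemma applies to Q with the flat pair as well as to lifts. *)
Lemma adj_iter_lift m a b h : (a <= m)%N -> (b <= m)%N ->
  iter m (adj (V1 \o V2)) (iter a V1 (iter b V2 (Pi h))) =
  Pi (iter (m - a) (adj T1) (iter (m - b) (adj T2) h)).
Proof.
move=> am bm.
have V21 := adj_commute bV2 bV1 (fun x => esym (hV12 x)).
have iterPi (S : K -> K) (T : H -> H) n k : (forall h, adj S (Pi h) = Pi (adj T h)) ->
    iter n (adj S) (Pi k) = Pi (iter n (adj T) k).
  by move=> ST; elim: n => //= n ->.
rewrite (adj_comp bV1 bV2).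
rewrite (iter_comp _ _ V21).
rewrite (iter_cancel _ (isometric_adjK hV1) am).
rewrite (iter_iter_commute _ _ _ V21).
rewrite (iter_cancel _ (isometric_adjK hV2) bm).
rewrite (iterPi V2 T2)//.
by rewrite (iterPi V1 T1).
Qed.

Lemma iter_product_lift n h :
  iter n (adj (V1 \o V2)) (Pi h) = Pi (iter n (adj (T1 \o T2)) h).
Proof. by elim: n => //= n ->; exact: adj_product_lift. Qed.

End Intertwining.

(** * The model built from a tuple *)

Section Model.
Variables (R : realType) (H : hilbertType R) (T1 T2 : H -> H).
Hypotheses (hT1 : contractive T1) (hT2 : contractive T2).
Hypothesis hT12 : forall h, T1 (T2 h) = T2 (T1 h).
Variables (D Q : {linear H -> H}).
Hypotheses (hD : defect_star (T1 \o T2) D) (hQ : asymptotic_root (T1 \o T2) Q).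
Variables (QT : hilbertType R) (iota : csub (clran Q) -> QT) (WD W1 W2 : QT -> QT).
Hypotheses (hWD : canonical_unitary (T1 \o T2) iota WD)
  (hW : flat_pair T1 T2 iota WD W1 W2).

Let bT1 := contractive_bounded hT1.
Let bT2 := contractive_bounded hT2.
Let T := T1 \o T2.

Let hT : contractive T.
Proof.
split=> [a x y|x]; first by rewrite /T /= hT2.1 hT1.1.
by apply: le_trans (hT1.2 _) (hT2.2 _).
Qed.

Let iota_isometric : isometric iota.
Proof. by have [_ [Xs [_ _ []]]] := hWD. Qed.

Let W_isometric : isometric W1 /\ isometric W2.
Proof. by case: hW => [[[]]] ? ? []. Qed.

Let iQ h := iota (clran_op Q h).

Lemma iota_clran_hdot h k : hdot (iQ h) (iQ k) = hdot (Q h) (Q k).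
Proof. by rewrite (isometric_hdot _ _ iota_isometric). Qed.

(** [adj (W1 \o W2)] is unitary, so its m-th power, applied to both vectors, preserves their inner
    product and clears the powers of W1 and W2. *)
Lemma flat_pair_hdot m a b c d h k :
  (a <= m)%N -> (b <= m)%N -> (c <= m)%N -> (d <= m)%N ->
  hdot (iter a W1 (iter b W2 (iQ h))) (iter c W1 (iter d W2 (iQ k))) =
  hdot (Q (iter (m - a) (adj T1) (iter (m - b) (adj T2) h)))
       (Q (iter (m - c) (adj T1) (iter (m - d) (adj T2) k))).
Proof.
move=> am bm cm dm; have [[uW1 uW2] W12 _ iW1 iW2] := hW.
have uW : isometric (adj (W1 \o W2)).
  rewrite adj_comp; [|exact: isometric_bounded uW1.1|exact: isometric_bounded uW2.1].
  apply: isometric_comp; exact: (unitary_adj_unitary _).1.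
have iW n x y : hdot x y = hdot (iter n (adj (W1 \o W2)) x) (iter n (adj (W1 \o W2)) y).
  by elim: n => //= n ->; rewrite (isometric_hdot _ _ uW).
have L := adj_iter_lift uW1.1 uW2.1 W12 iW1 iW2.
by rewrite (iW m) !L// iota_clran_hdot.
Qed.

(* [iota (Q h) = W_D^n (iota (Q (T^*n h)))], so that the forward orbit of Ran Q is
   already invariant under [W_D^*]. *)
Lemma canonical_unitary_total (S : set QT) : closed_subspace S ->
  (forall n h, S (iter n WD (iQ h))) -> S = setT.
Proof.
move=> Scl SW; have [uWD [Xs [_ XsQ [_ _ Xi mWD]]]] := hWD.
have bWD := isometric_bounded uWD.1.
pose A := [set y | exists n h, y = iter n WD (iQ h)].
have AT : clspan A = setT.
  apply/seteqP; split=> // x _.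
  have : inv_clspan [set adj WD; adj (adj WD)] (range iota) x by rewrite mWD.
  apply; first exact: clspan_subspace.
    have := closed_subspace_preimage (isometric_bounded iota_isometric)
      (clspan_subspace A).
    move=> ipre _ [y _ <-]; have : clspan (range (clran_op Q)) y.
      by rewrite clran_op_total.
    move=> /(_ _ ipre); apply=> _ [h _ <-]; apply: sub_clspan.
    by exists 0%N, h.
  move=> B [->|->]; apply: clspan_stable.
  - exact: adj_bounded.
  - move=> _ [[|n] [h ->]]; apply: sub_clspan.
      by exists 0%N, (adj T h); rewrite /= /iQ Xi XsQ.
    by exists n, h; rewrite /= isometric_adjK//; exact: uWD.1.
  - by rewrite adj_adj.
  - by rewrite adj_adj// => _ [n [h ->]]; apply: sub_clspan; exists n.+1, h.
apply/seteqP; split=> // x _; have : clspan A x by rewrite AT.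
by apply=> // _ [n [h ->]].
Qed.

Section Tuple.
Variables (F : hilbertType R) (Lam : csub (clran D) -> F) (P U : F -> F).
Hypothesis hA : type_I_ando_tuple T1 T2 Lam P U.

Let hLam : isometric Lam. Proof. by case: hA. Qed.
Let hP : orthoproj P. Proof. by case: hA. Qed.
Let hU : unitary U. Proof. by case: hA. Qed.
Let M1 := lando_mul1 P U.
Let M2 := lando_mul2 P U.
Let hM1 : isometric M1 := lando_mul1_isometric hP hU.
Let hM2 : isometric M2 := lando_mul2_isometric hP hU.
Let LO h : H2 F := H2lmap Lam (lobservability T D h).

Lemma model_PiE h : model_Pi T1 T2 Lam iota h = (LO h, iQ h).
Proof.
by rewrite /model_Pi /LO observability_lobservability H2map_lmap.
Qed.

Lemma model_V1E x : model_V1 P U W1 x = (M1 x.1, W1 x.2).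
Proof. by rewrite /model_V1 /block_diag ando_mul1_lando. Qed.

Lemma model_V2E x : model_V2 P U W2 x = (M2 x.1, W2 x.2).
Proof. by rewrite /model_V2 /block_diag ando_mul2_lando. Qed.

Lemma LOE h n : LO h n = Lam (clran_op D (iter n (adj T) h)).
Proof.
by rewrite /LO H2lmapE ?(lobservabilityE hT hD)//; exact: isometric_bounded.
Qed.

Lemma LO_hdot h k : hdot (LO h) (LO k) = hdot h k - hdot (Q h) (Q k).
Proof.
rewrite /LO (isometric_hdot _ _ (H2lmap_isometric hLam)).
exact: lobservability_hdot.
Qed.

Lemma adj_commute_iter S n h : bounded_op S -> (forall x, S (T x) = T (S x)) ->
  iter n (adj T) (adj S h) = adj S (iter n (adj T) h).
Proof.
move=> bS ST; apply: iter_commute => x; apply: adj_commute => //.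
exact: contractive_bounded.
Qed.

(** Equality of the n-th coefficients is the first tuple equation at [iter n (adj T) h]. *)
Lemma adj_M1_LO h : adj M1 (LO h) = LO (adj T1 h).
Proof.
apply: H2_ext => n; rewrite (adj_lando_mul1E hP hU) !LOE adj_commute_iter//.
  by case: hA => _ _ _ <- _.
by move=> x; rewrite /T /= hT12.
Qed.

Lemma adj_M2_LO h : adj M2 (LO h) = LO (adj T2 h).
Proof.
apply: H2_ext => n; rewrite (adj_lando_mul2E hP hU) !LOE adj_commute_iter//.
  by case: hA => _ _ _ _ <-.
by move=> x; rewrite /T /= -hT12.
Qed.

Lemma block_diag_adj (A : H2 F -> H2 F) (W : QT -> QT) (x : hsum (H2 F) QT) :
  bounded_op A -> bounded_op W ->
  adj (fun x : hsum (H2 F) QT => (A x.1, W x.2) : hsum (H2 F) QT) x =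
  (adj A x.1, adj W x.2).
Proof.
move=> bA bW; apply: adj_unique => y.
rewrite -[LHS]/(hdot (A y.1) x.1 + hdot (W y.2) x.2).
by rewrite (adjP bA) (adjP bW).
Qed.

Lemma block_diag_isometric (A : H2 F -> H2 F) (W : QT -> QT) :
  isometric A -> isometric W ->
  isometric (fun x : hsum (H2 F) QT => (A x.1, W x.2) : hsum (H2 F) QT).
Proof.
move=> iA iW; apply: hdot_isometric => [a x y|x].
  by rewrite -[LHS]/(A (a *: x.1 + y.1), W (a *: x.2 + y.2)) iA.1 iW.1.
rewrite -[LHS]/(hdot (A x.1) (A x.1) + hdot (W x.2) (W x.2)).
by rewrite (isometric_hdot _ _ iA) (isometric_hdot _ _ iW).
Qed.

Let mPi h : hsum (H2 F) QT := (LO h, iQ h).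
Let mV1 (x : hsum (H2 F) QT) : hsum (H2 F) QT := (M1 x.1, W1 x.2).
Let mV2 (x : hsum (H2 F) QT) : hsum (H2 F) QT := (M2 x.1, W2 x.2).

Lemma model_ando_lift : ando_lift T1 T2 mPi mV1 mV2.
Proof.
have [iW1 iW2] := W_isometric; have [_ W12 _ iWa iWb] := hW.
split=> [||x|h|h].
- apply: hdot_isometric => [a x y|x].
    rewrite -[RHS]/(a *: LO x + LO y, a *: iQ x + iQ y) /mPi; congr (_, _).
      rewrite -(H2lmap_isometric hLam).1; congr H2lmap.
      exact: lobservability_linear.
    by rewrite /iQ clran_op_linear iota_isometric.1.
  rewrite -[LHS]/(hdot (LO x) (LO x) + hdot (iQ x) (iQ x)).
  by rewrite LO_hdot iota_clran_hdot subrK.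
- by split; apply: block_diag_isometric.
- by rewrite /mV1 /mV2 /M1 /M2 /= W12 (lando_mul_commute hP hU).
- rewrite (block_diag_adj _ (isometric_bounded hM1) (isometric_bounded iW1)).
  by rewrite /= adj_M1_LO iWa.
- rewrite (block_diag_adj _ (isometric_bounded hM2) (isometric_bounded iW2)).
  by rewrite /= adj_M2_LO iWb.
Qed.

Lemma iter_mV a b x : iter a mV1 (iter b mV2 x) =
  (iter a M1 (iter b M2 x.1), iter a W1 (iter b W2 x.2)).
Proof.
have -> : iter b mV2 x = (iter b M2 x.1, iter b W2 x.2).
  by elim: b => [|b]; [case: x|move=> /= ->].
by elim: a => //= a ->.
Qed.

Let inl_isometric : isometric (fun f => (f, 0) : hsum (H2 F) QT).
Proof.
apply: hdot_isometric => [a x y|x].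
  by rewrite -[RHS]/(a *: x + y, a *: 0 + 0) scaler0 addr0.
by rewrite -[LHS]/(hdot x x + hdot 0 0) hdot0l addr0.
Qed.

Let inr_isometric : isometric (fun y => (0, y) : hsum (H2 F) QT).
Proof.
apply: hdot_isometric => [a x y|x].
  by rewrite -[RHS]/(a *: 0 + 0, a *: x + y) scaler0 addr0.
by rewrite -[LHS]/(hdot 0 0 + hdot x x) hdot0l add0r.
Qed.

(* [V Pi T^* h] agrees with [Pi h] except in the constant coefficient. *)
Lemma model_constant_term h :
  mPi h - mV1 (mV2 (mPi (adj T h))) = (H2mono 0 (Lam (clran_op D h)), 0).
Proof.
have [[uW1 uW2] W12 _ iWa iWb] := hW.
rewrite -[LHS]/(LO h - M1 (M2 (LO (adj T h))), iQ h - W1 (W2 (iQ (adj T h)))).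
congr (_, _); last first.
  rewrite /T (adj_comp bT1 bT2) /= /iQ -iWb -iWa.
  by rewrite (unitary_adjK uW2) (unitary_adjK uW1) subrr.
apply: H2_ext => n.
rewrite -[LHS]/(LO h n - M1 (M2 (LO (adj T h))) n) (lando_mul12E hP hU) H2monoE LOE.
case: n => [|n]; first by rewrite subr0.
by rewrite LOE -iterSr subrr.
Qed.

Lemma model_total : douglas_minimal Lam P U ->
  clspan [set x | exists n1 n2 h, x = iter n1 mV1 (iter n2 mV2 (mPi h))] = setT.
Proof.
move=> hDM; set A := [set x | _]; have [_ [iV1 iV2] V12 _ _] := model_ando_lift.
have [S0 Sl _] := clspan_subspace A.
have SD x y : clspan A x -> clspan A y -> clspan A (x + y).
  by move=> Sx Sy; rewrite -[x]scale1r; exact: Sl.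
have SB x y : clspan A x -> clspan A y -> clspan A (x - y).
  by move=> Sx Sy; rewrite addrC -scaleN1r; exact: Sl.
have SV1 x : clspan A x -> clspan A (mV1 x).
  apply: clspan_stable; first exact: isometric_bounded.
  move=> _ [a [b [h ->]]]; apply: sub_clspan.
  by exists a.+1, b, h.
have SV2 x : clspan A x -> clspan A (mV2 x).
  apply: clspan_stable; first exact: isometric_bounded.
  move=> _ [a [b [h ->]]]; apply: sub_clspan; exists a, b.+1, h.
  by rewrite -(@iter_commute _ mV1 mV2).
have SPi h : clspan A (mPi h) by apply: sub_clspan; exists 0%N, 0%N, h.
(* Pulling the span back to each summand allows totality to be used there separately. *)
have inl_cl := closed_subspace_preimage (isometric_bounded inl_isometric)
  (clspan_subspace A).
have inr_cl := closed_subspace_preimage (isometric_bounded inr_isometric)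
  (clspan_subspace A).
have M120 : M1 (M2 0) = 0.
  by rewrite (linear_map0 hM2.1) (linear_map0 hM1.1).
(* By closedness [x] may be taken in the range of [clran_op D]. Then [model_constant_term] gives k =
   0, and [mV1 \o mV2] raises the exponent while keeping the second component 0. *)
have Smono k x : clspan A (H2mono k (Lam x), 0).
  have bm : bounded_op (H2mono k \o Lam).
    apply: bounded_comp; apply: isometric_bounded => //.
    exact: H2mono_isometric.
  have : clspan (range (clran_op D)) x by rewrite clran_op_total.
  move=> /(_ _ (closed_subspace_preimage bm inl_cl)); apply=> _ [h _ <-].
  rewrite /preimage /=; elim: k {bm} => [|k IH].
    by rewrite -model_constant_term; apply: SB => //; apply: SV1; exact: SV2.
  have := SV1 _ (SV2 _ IH); rewrite /mV1 /mV2 /M1 /M2 /=.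
  rewrite (lando_mul12_mono hP hU).
  have [iW1 iW2] := W_isometric.
  by rewrite (linear_map0 iW2.1) (linear_map0 iW1.1).
have Sl1 f : clspan A (f, 0).
  have [iW1 iW2] := W_isometric.
  have W10 := linear_map0 iW1.1; have W20 := linear_map0 iW2.1.
  have : inv_clspan [set ando_mul1 P U; ando_mul2 P U] (H2_of (range Lam)) f.
    by rewrite hDM.
  move=> /(_ _ inl_cl); apply.
    move=> g gL; apply: (H2_closed_mono inl_cl) => n.
    by have [x _ <-] := gL n; exact: Smono.
  move=> B [->|->] g Sg; rewrite /preimage /=.
    rewrite ando_mul1_lando.
    by have := SV1 _ Sg; rewrite /mV1 /= W10.
  rewrite ando_mul2_lando.
  by have := SV2 _ Sg; rewrite /mV2 /= W20.
(* Removing the Hardy component from [mPi h] leaves (0, iQ h), on which [mV1 \o mV2] acts as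
   [WD]. *)
have Sr0 : (fun y => (0, y) : hsum (H2 F) QT) @^-1` clspan A = setT.
  apply: canonical_unitary_total inr_cl _ => n h; rewrite /preimage /=.
  elim: n => [|n IH].
    have := SB _ _ (SPi h) (Sl1 (LO h)); rewrite /mPi.
    by rewrite -[_ - _]/(LO h - LO h, iQ h - 0) subrr subr0.
  have := SV1 _ (SV2 _ IH); rewrite /mV1 /mV2 /= M120.
  by have [_ _ -> _ _] := hW.
apply/seteqP; split=> // -[f y] _.
have Sy : clspan A (0, y).
  by rewrite -[clspan A _]/(((fun y => (0, y) : hsum (H2 F) QT) @^-1` clspan A) y) Sr0.
have := SD _ _ (Sl1 f) Sy.
by rewrite -[_ + _]/(f + 0, 0 + y) addr0 add0r.
Qed.

Lemma model_minimal : douglas_minimal Lam P U ->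
  minimal_ando_lift T1 T2 (model_Pi T1 T2 Lam iota) (model_V1 P U W1)
    (model_V2 P U W2).
Proof.
have -> : model_Pi T1 T2 Lam iota = mPi by apply/funext => h; exact: model_PiE.
have -> : model_V1 P U W1 = mV1 by apply/funext => h; exact: model_V1E.
have -> : model_V2 P U W2 = mV2 by apply/funext => h; exact: model_V2E.
by split; [exact: model_ando_lift|exact: model_total].
Qed.

Lemma model_gram m a b c d h k :
  (a <= m)%N -> (b <= m)%N -> (c <= m)%N -> (d <= m)%N ->
  hdot (iter a (model_V1 P U W1) (iter b (model_V2 P U W2)
         (model_Pi T1 T2 Lam iota h)))
       (iter c (model_V1 P U W1) (iter d (model_V2 P U W2)
         (model_Pi T1 T2 Lam iota k))) =
  hdot (iter a (lando_mul1 P U) (iter b (lando_mul2 P U)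
         (H2lmap Lam (lobservability (T1 \o T2) D h))))
       (iter c (lando_mul1 P U) (iter d (lando_mul2 P U)
         (H2lmap Lam (lobservability (T1 \o T2) D k)))) +
  hdot (Q (iter (m - a) (adj T1) (iter (m - b) (adj T2) h)))
       (Q (iter (m - c) (adj T1) (iter (m - d) (adj T2) k))).
Proof.
move=> am bm cm dm.
have -> : model_V1 P U W1 = mV1 by apply/funext => x; exact: model_V1E.
have -> : model_V2 P U W2 = mV2 by apply/funext => x; exact: model_V2E.
rewrite !model_PiE.
have -> := iter_mV a b (mPi h); have -> := iter_mV c d (mPi k).
by rewrite -(flat_pair_hdot _ _ am bm cm dm).
Qed.

End Tuple.
End Model.

(** * Wandering subspace and Fourier map of a commuting isometric pair *)

Section WanderingSubspace.
Variables (R : realType) (K : hilbertType R) (V1 V2 : K -> K).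
Hypotheses (hV1 : isometric V1) (hV2 : isometric V2).
Hypothesis hV12 : forall x, V1 (V2 x) = V2 (V1 x).

Let bV1 := isometric_bounded hV1.
Let bV2 := isometric_bounded hV2.
Let aV1 := isometric_adjK hV1.
Let aV2 := isometric_adjK hV2.

Local Notation V := (V1 \o V2).

Let adjVE x : adj V x = adj V2 (adj V1 x).
Proof. by rewrite (adj_comp bV1 bV2). Qed.

Let adjC x : adj V1 (adj V2 x) = adj V2 (adj V1 x).
Proof. exact: (adj_commute bV1 bV2). Qed.

Let zero_bounded (E : hilbertType R) : bounded_op (fun _ : K => 0 : E).
Proof.
split=> [a x y|]; first by rewrite scaler0 addr0.
by exists 0 => x; rewrite normr0 mul0r.
Qed.

Let bV : bounded_op V := bounded_comp bV1 bV2.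

(** The kernel of V^*, written as an equaliser with the zero operator so that it is visibly
    closed. *)
Definition wandering : csubspace K :=
  CSubspace (closed_subspace_eq (adj_bounded bV) (zero_bounded K)).

Local Notation F := (csub wandering).

Let wmk x (x0 : adj V x = 0) : F := @CSub _ _ wandering x (mem_set x0).

Let w0 (f : F) : adj V (val f) = 0.
Proof. by have := csub_mem f; rewrite inE. Qed.

Let wvalD (f g : F) : csub_val (f + g) = csub_val f + csub_val g.
Proof. exact: (linearD (val : F -> K)). Qed.

Let wvalB (f g : F) : csub_val (f - g) = csub_val f - csub_val g.
Proof. exact: (linearB (val : F -> K)). Qed.

Let w21 (f : F) : adj V2 (adj V1 (val f)) = 0.
Proof. by rewrite -adjVE w0. Qed.

Let w12 (f : F) : adj V1 (adj V2 (val f)) = 0.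
Proof. by rewrite adjC w21. Qed.

Let V1l := hV1.1.
Let V2l := hV2.1.
Let a1l := adj_linear bV1.
Let a2l := adj_linear bV2.
Let Vadj_linear := adj_linear bV.

Fact wandering_proj_subproof x : adj V (x - V1 (V2 (adj V x))) = 0.
Proof. by rewrite (linear_mapB Vadj_linear) [X in _ - X]adjVE aV1 aV2 subrr. Qed.

Fact wandering_P_subproof (f : F) : adj V (V2 (adj V2 (val f))) = 0.
Proof. by rewrite adjVE -adjC aV2 w12. Qed.

Fact wandering_U_subproof (f : F) :
  adj V (V2 (val f - V1 (adj V1 (val f))) + adj V1 (val f)) = 0.
Proof.
rewrite (linear_mapD Vadj_linear) [X in X + _]adjVE -adjC aV2 (linear_mapB a1l).
by rewrite aV1 subrr add0r adjVE -adjC w21 (linear_map0 a1l).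
Qed.

Fact wandering_Ustar_subproof (f : F) :
  adj V (adj V2 (val f) + V1 (val f - V2 (adj V2 (val f)))) = 0.
Proof.
rewrite (linear_mapD Vadj_linear) [X in _ + X]adjVE aV1 (linear_mapB a2l).
by rewrite aV2 subrr addr0 adjVE w12 (linear_map0 a2l).
Qed.

(* Writing V' for the adjoint of V, the space F = ker V' decomposes both as
   V2 ker V1' + ker V2' and as ker V1' + V1 ker V2'.  [wandering_P] is the
   projection onto V2 ker V1', and [wandering_Ustar] maps V2 e + f to e + V1 f. *)
Definition wandering_proj x : F := wmk (wandering_proj_subproof x).
Definition wandering_P (f : F) : F := wmk (wandering_P_subproof f).
Definition wandering_U (f : F) : F := wmk (wandering_U_subproof f).
Definition wandering_Ustar (f : F) : F := wmk (wandering_Ustar_subproof f).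

Local Notation E := wandering_proj.
Local Notation P := wandering_P.
Local Notation U := wandering_U.
Local Notation Us := wandering_Ustar.

Lemma wandering_orthoproj : orthoproj P.
Proof.
split=> [a f g|f|f g].
- by apply: val_inj; rewrite /= a2l V2l.
- by apply: val_inj; rewrite /= aV2.
- by rewrite !csub_hdot /= (adjP bV2) -(adjPr bV2).
Qed.

Lemma wandering_UK f : Us (U f) = f.
Proof.
apply: val_inj; rewrite /=; set x := val f.
have h : adj V2 (V2 (x - V1 (adj V1 x)) + adj V1 x) = x - V1 (adj V1 x).
  by rewrite (linear_mapD a2l) aV2 w21 addr0.
by rewrite h [X in V1 (X - _)]addrC addrK subrK.
Qed.

Lemma wandering_UsK f : U (Us f) = f.
Proof.
apply: val_inj; rewrite /=; set x := val f.
have h : adj V1 (adj V2 x + V1 (x - V2 (adj V2 x))) = x - V2 (adj V2 x).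
  by rewrite (linear_mapD a1l) aV1 w12 add0r.
by rewrite h addrK addrC subrK.
Qed.

(** Both sides equal <f, V2^* g> + <f, V1 g>, the cross terms vanishing because V1^* V2^* kills f
    and g. With the inverse laws this already yields unitarity. *)
Lemma wandering_U_adjoint f g : hdot (U f) g = hdot f (Us g).
Proof.
rewrite !csub_hdot /=; set x := val f; set y := val g.
have h1 : hdot (V1 (adj V1 x)) (adj V2 y) = 0 by rewrite (adjP bV1) w12 hdot0r.
have h2 : hdot x (V1 (V2 (adj V2 y))) = 0.
  by rewrite -(adjPr bV1) -(adjPr bV2) w21 hdot0l.
rewrite hdotDl (adjP bV2) (adjPr bV1) hdotBl h1 subr0 hdotDr (linear_mapB V1l).
by rewrite hdotBr h2 subr0.
Qed.

Lemma wandering_U_unitary : unitary U.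
Proof.
split=> [|f]; last by exists (Us f); exact: wandering_UsK.
apply: hdot_isometric => [a f g|f].
  apply: val_inj; rewrite /=.
  by rewrite a1l V1l opprD addrACA -scalerBr V2l addrACA -scalerDr.
by rewrite wandering_U_adjoint wandering_UK.
Qed.

Lemma adj_wandering_U : adj U = Us.
Proof.
by apply/funext => g; apply: adj_unique => f; exact: wandering_U_adjoint.
Qed.

Lemma wandering_proj_hdot x y :
  hdot (E x) (E y) = hdot x y - hdot (adj V x) (adj V y).
Proof.
have h : hdot (V (adj V x)) (V (adj V y)) = hdot (adj V x) (adj V y).
  exact: (isometric_hdot _ _ (isometric_comp hV1 hV2)).
rewrite csub_hdot /= hdotBl !hdotBr [X in _ - (_ - X)]h.
rewrite -[V1 (V2 _)]/(V _) -[X in _ - (hdot X _ - _)]/(V _).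
by rewrite -(adjPr bV) (adjP bV) subrr subr0.
Qed.

Lemma wandering_proj_linear : linear E.
Proof.
move=> a x y; apply: val_inj; rewrite /= Vadj_linear V2l V1l.
by rewrite opprD addrACA -scalerBr.
Qed.

Lemma wandering_proj_val (f : F) : E (val f) = f.
Proof.
by apply: val_inj; rewrite /= w0 (linear_map0 V2l) (linear_map0 V1l) subr0.
Qed.

Let valP f : val (P f) = V2 (adj V2 (val f)).
Proof. by []. Qed.

Let valU f : val (U f) = V2 (val f - V1 (adj V1 (val f))) + adj V1 (val f).
Proof. by []. Qed.

Let valUs f : val (Us f) = adj V2 (val f) + V1 (val f - V2 (adj V2 (val f))).
Proof. by []. Qed.

Let adjV2E x : adj V2 (val (E x)) = adj V2 x - V1 (adj V x).
Proof. by rewrite /= (linear_mapB a2l) hV12 aV2. Qed.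

Let adjV1E x : adj V1 (val (E x)) = adj V1 x - V2 (adj V x).
Proof. by rewrite /= (linear_mapB a1l) aV1. Qed.

(** P^perp E = 1 - V2 V2^*, since the range of V lies in that of V2; this is the component that [Us]
    carries over by V1. *)
Lemma wandering_UsPc x :
  val (Us (E x - P (E x))) = V1 (x - V2 (adj V2 x)).
Proof.
have h : val (E x - P (E x)) = x - V2 (adj V2 x).
  rewrite [LHS]wvalB valP adjV2E (linear_mapB V2l) /= -hV12.
  by rewrite opprB addrA subrK.
by rewrite valUs h (linear_mapB a2l) aV2 subrr (linear_map0 V2l) subr0 add0r.
Qed.

Lemma wandering_UsP x :
  val (Us (P (E x))) = adj V2 x - V1 (adj V x).
Proof.
by rewrite valUs valP aV2 subrr (linear_map0 V1l) addr0 adjV2E.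
Qed.

Let UE x : val (U (E x)) = V2 (x - V1 (adj V1 x)) + (adj V1 x - V2 (adj V x)).
Proof.
rewrite valU adjV1E; congr (V2 _ + _).
by rewrite (linear_mapB V1l) opprB addrA subrK.
Qed.

Lemma wandering_PU x : val (P (U (E x))) = V2 (x - V1 (adj V1 x)).
Proof.
rewrite valP UE (linear_mapD a2l) aV2 (linear_mapB a2l) aV2.
by rewrite adjVE subrr addr0.
Qed.

Lemma wandering_PcU x : val (U (E x) - P (U (E x))) = adj V1 x - V2 (adj V x).
Proof. by rewrite [LHS]wvalB [csub_val (P _)]wandering_PU [csub_val _]UE addrC addKr. Qed.

Let adjV_adjV1 x : adj V (adj V1 x) = adj V1 (adj V x).
Proof. by rewrite !adjVE adjC. Qed.

Let adjV_adjV2 x : adj V (adj V2 x) = adj V2 (adj V x).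
Proof. by rewrite !adjVE adjC. Qed.

(** At x = Pi h this becomes the first tuple equation. At x = V^*n y it is the coefficient of degree
    n + 1 in the intertwining of V2, because V^* V2 = V1^*. *)
Lemma wandering_proj_adjV1 x :
  E (adj V1 x) = (U (E x) - P (U (E x))) + P (U (E (adj V x))).
Proof.
apply: val_inj; rewrite [RHS]wvalD [csub_val _]wandering_PcU [csub_val _]wandering_PU /= adjV_adjV1.
by rewrite (linear_mapB V2l) addrA subrK hV12.
Qed.

Lemma wandering_proj_adjV2 x :
  E (adj V2 x) = Us (P (E x)) + Us (E (adj V x) - P (E (adj V x))).
Proof.
apply: val_inj; rewrite [RHS]wvalD [csub_val _]wandering_UsP [csub_val _]wandering_UsPc /= adjV_adjV2.
by rewrite (linear_mapB V1l) addrA subrK.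
Qed.

Definition fourier x : H2 F := H2of (fun n => E (iter n (adj V) x)).

Lemma fourierE x n : fourier x n = E (iter n (adj V) x).
Proof.
rewrite /fourier H2ofE//; apply: (@telescope_square_summable _ _ _
  (fun n => hdot (iter n (adj V) x) (iter n (adj V) x))) => k; last exact: hdot_ge0.
by rewrite -hdot_norm wandering_proj_hdot.
Qed.

Lemma fourier_bounded : bounded_op fourier.
Proof.
split=> [a x y|].
  apply: H2_ext => n; rewrite -[RHS]/(a *: fourier x n + fourier y n) !fourierE.
  by rewrite (iter_linear _ Vadj_linear) wandering_proj_linear.
exists 1 => x; rewrite mul1r -ler_sqr ?nnegrE//; apply: H2_norm_le => n.
suff -> : \sum_(0 <= k < n) `|fourier x k| ^+ 2 =
    `|x| ^+ 2 - `|iter n (adj V) x| ^+ 2 by rewrite gerBl exprn_ge0.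
elim: n => [|n IH]; first by rewrite big_nil subrr.
by rewrite big_nat_recr//= IH fourierE -!hdot_norm wandering_proj_hdot addrA subrK.
Qed.

Lemma fourier_V1 x : fourier (V1 x) = lando_mul1 P U (fourier x).
Proof.
apply: H2_ext => n.
rewrite (lando_mul1E wandering_orthoproj wandering_U_unitary) adj_wandering_U.
case: n => [|n]; rewrite !fourierE.
  apply: val_inj; rewrite addr0 wandering_UsPc /= adjVE aV1.
  by rewrite (linear_mapB V1l).
rewrite iterSr adjVE aV1 (iter_commute _ _ adjV_adjV2) wandering_proj_adjV2.
by rewrite addrC.
Qed.

Lemma fourier_V2 x : fourier (V2 x) = lando_mul2 P U (fourier x).
Proof.
apply: H2_ext => n.
rewrite (lando_mul2E wandering_orthoproj wandering_U_unitary).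
case: n => [|n]; rewrite !fourierE.
  apply: val_inj; rewrite addr0 wandering_PU /= adjVE -adjC aV2.
  by rewrite hV12 (linear_mapB V2l).
rewrite iterSr adjVE -adjC aV2 (iter_commute _ _ adjV_adjV1) wandering_proj_adjV1.
by rewrite addrC.
Qed.

Lemma fourier_val (f : F) : fourier (val f) = H2mono 0 f.
Proof.
apply: H2_ext => n; rewrite fourierE H2monoE; case: n => [|n].
  exact: wandering_proj_val.
rewrite iterSr w0; have -> : iter n (adj V) 0 = 0.
  by elim: n => //= n ->; rewrite (linear_map0 Vadj_linear).
exact: linear_map0 wandering_proj_linear.
Qed.

(** The range of the Fourier map thus contains every monomial, which is what Douglas-minimality will
    rest on. *)
Lemma fourier_mono n (f : F) : fourier (iter n V (val f)) = H2mono n f.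
Proof.
elim: n => [|n IH]; first exact: fourier_val.
rewrite /= fourier_V1 fourier_V2 IH.
exact: (lando_mul12_mono wandering_orthoproj wandering_U_unitary).
Qed.

Lemma fourier_hdot x y (l : R[i]^o) :
  (fun n => hdot (iter n (adj V) x) (iter n (adj V) y) : R[i]^o) @ \oo --> l ->
  hdot x y = hdot (fourier x) (fourier y) + l.
Proof.
move=> h; apply/eqP; rewrite -subr_eq eq_sym; apply/eqP.
apply: (H2_hdot_telescope _ h) => n.
by rewrite !fourierE wandering_proj_hdot.
Qed.

End WanderingSubspace.

(** * From a minimal lift to a tuple and an equivalent model *)

Section Converse.
Variables (R : realType) (H : hilbertType R) (T1 T2 : H -> H).
Hypotheses (hT1 : contractive T1) (hT2 : contractive T2).
Hypothesis hT12 : forall h, T1 (T2 h) = T2 (T1 h).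
Variables (D Q : {linear H -> H}).
Hypotheses (hD : defect_star (T1 \o T2) D) (hQ : asymptotic_root (T1 \o T2) Q).
Variables (QT : hilbertType R) (iota : csub (clran Q) -> QT) (WD W1 W2 : QT -> QT).
Hypotheses (hWD : canonical_unitary (T1 \o T2) iota WD)
  (hW : flat_pair T1 T2 iota WD W1 W2).
Variables (K : hilbertType R) (Pi : H -> K) (V1 V2 : K -> K).
Hypothesis hL : minimal_ando_lift T1 T2 Pi V1 V2.

Let bT1 := contractive_bounded hT1.
Let bT2 := contractive_bounded hT2.
Let hV1 : isometric V1. Proof. by case: hL => [[_ []]]. Qed.
Let hV2 : isometric V2. Proof. by case: hL => [[_ []]]. Qed.
Let hV12 : forall x, V1 (V2 x) = V2 (V1 x). Proof. by case: hL => [[]]. Qed.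
Let hPi : isometric Pi. Proof. by case: hL => [[]]. Qed.
Let hPi1 : forall h, adj V1 (Pi h) = Pi (adj T1 h). Proof. by case: hL => [[]]. Qed.
Let hPi2 : forall h, adj V2 (Pi h) = Pi (adj T2 h). Proof. by case: hL => [[]]. Qed.

Let hT : contractive (T1 \o T2).
Proof.
split=> [a x y|x]; first by rewrite /= hT2.1 hT1.1.
by apply: le_trans (hT1.2 _) (hT2.2 _).
Qed.

Local Notation F := (csub (wandering hV1 hV2)).
Local Notation E := (wandering_proj hV1 hV2).
Local Notation P := (@wandering_P _ _ _ _ hV1 hV2 hV12).
Local Notation U := (@wandering_U _ _ _ _ hV1 hV2 hV12).
Local Notation Phi := (fourier hV1 hV2).
Local Notation M1 := (lando_mul1 P U).
Local Notation M2 := (lando_mul2 P U).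

Let hP : orthoproj P := wandering_orthoproj hV1 hV2 hV12.
Let hU : unitary U := wandering_U_unitary hV1 hV2 hV12.

Let adjVPi h : adj (V1 \o V2) (Pi h) = Pi (adj (T1 \o T2) h).
Proof. exact: adj_product_lift. Qed.

Lemma wandering_embedding : exists2 Lam : csub (clran D) -> F,
  isometric Lam & forall h, Lam (clran_op D h) = E (Pi h).
Proof.
apply: gram_isometry (clran_op_total D) _ => h k.
rewrite csub_hdot /= (defect_hdot hT hD) wandering_proj_hdot !adjVPi.
by rewrite !(isometric_hdot _ _ hPi).
Qed.

Section Embedding.
Variable Lam : csub (clran D) -> F.
Hypotheses (hLam : isometric Lam)
  (LamE : forall h, Lam (clran_op D h) = E (Pi h)).

Lemma wandering_tuple : type_I_ando_tuple T1 T2 Lam P U.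
Proof.
split=> // h; rewrite !LamE -adjVPi.
  by rewrite -hPi1 (wandering_proj_adjV1 hV1 hV2 hV12).
by rewrite -hPi2 (wandering_proj_adjV2 hV1 hV2 hV12) adj_wandering_U.
Qed.

Lemma fourier_Pi h : Phi (Pi h) = H2lmap Lam (lobservability (T1 \o T2) D h).
Proof.
apply: H2_ext => n; rewrite fourierE H2lmapE; last exact: isometric_bounded.
rewrite (lobservabilityE hT hD) LamE; congr (E _).
exact: (iter_product_lift hT1 hT2 hV1 hV2 hPi1 hPi2).
Qed.

Let iter_V1 n x : Phi (iter n V1 x) = iter n M1 (Phi x).
Proof. by elim: n => //= n <-; exact: fourier_V1. Qed.

Let iter_V2 n x : Phi (iter n V2 x) = iter n M2 (Phi x).
Proof. by elim: n => //= n <-; exact: fourier_V2. Qed.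

(** Minimality of the lift enters here: the Fourier transforms of the vectors Pi h lie in H^2(Ran
    Lam), so an invariant [S] contains the transform of all of K, hence every monomial. *)
Lemma wandering_douglas_minimal : douglas_minimal Lam P U.
Proof.
apply/seteqP; split=> // f _ S Scl SL SM.
have SPhi x : S (Phi x).
  have : clspan [set x | exists a b h, x = iter a V1 (iter b V2 (Pi h))] x.
    by rewrite hL.2.
  move=> /(_ _ (closed_subspace_preimage (fourier_bounded hV1 hV2) Scl)); apply.
  move=> _ [a [b [h ->]]]; rewrite /preimage /= iter_V1 iter_V2 fourier_Pi.
  elim: a => [|a IH] /=; last first.
    by apply: (SM M1) => //; left; rewrite ando_mul1_lando.
  elim: b => [|b IH] /=; last first.
    by apply: (SM M2) => //; right; rewrite ando_mul2_lando.
  apply: SL => n; rewrite /= H2lmapE; last exact: isometric_bounded.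
  by exists (lobservability (T1 \o T2) D h n).
apply: (H2_closed_mono Scl) => n; rewrite -(fourier_mono hV12).
exact: SPhi.
Qed.

Lemma lift_gram m a b c d h k :
  (a <= m)%N -> (b <= m)%N -> (c <= m)%N -> (d <= m)%N ->
  hdot (iter a V1 (iter b V2 (Pi h))) (iter c V1 (iter d V2 (Pi k))) =
  hdot (Phi (iter a V1 (iter b V2 (Pi h)))) (Phi (iter c V1 (iter d V2 (Pi k)))) +
  hdot (Q (iter (m - a) (adj T1) (iter (m - b) (adj T2) h)))
       (Q (iter (m - c) (adj T1) (iter (m - d) (adj T2) k))).
Proof.
move=> am bm cm dm; apply: fourier_hdot.
have L := adj_iter_lift hV1 hV2 hV12 hPi1 hPi2.
have V := iter_product_lift hT1 hT2 hV1 hV2 hPi1 hPi2.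
set x := iter a _ _; set y := iter c _ _.
(* Dropping the first m terms keeps the limit and leaves only indices at which all powers of V1 and
   V2 have been cancelled. *)
rewrite -(cvg_shiftn m).
have -> : (fun n => hdot (iter (n + m) (adj (V1 \o V2)) x)
                         (iter (n + m) (adj (V1 \o V2)) y) : R[i]^o) =
    (fun n => hdot
       (iter n (adj (T1 \o T2)) (iter (m - a) (adj T1) (iter (m - b) (adj T2) h)))
       (iter n (adj (T1 \o T2)) (iter (m - c) (adj T1) (iter (m - d) (adj T2) k)))).
  apply/funext => n; rewrite !iterD /x /y !L// !V.
  exact: isometric_hdot.
exact: (asymptotic_root_cvg hT hQ).
Qed.

Lemma lift_equivalent_model : lift_unitarily_equivalent Pi V1 V2
  (model_Pi T1 T2 Lam iota) (model_V1 P U W1) (model_V2 P U W2).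
Proof.
(* The direct half, applied to the tuple just built, makes the family [b] total; surjectivity of
   [tau] depends on it. *)
have [[_ [iV1 iV2] V12 _ _] mtot] :=
  model_minimal hT1 hT2 hT12 hD hQ hWD hW wandering_tuple wandering_douglas_minimal.
set V1' := model_V1 P U W1 in iV1 V12 mtot *.
set V2' := model_V2 P U W2 in iV2 V12 mtot *.
set Pi' := model_Pi T1 T2 Lam iota in mtot *.
pose a (i : nat * nat * H) := iter i.1.1 V1 (iter i.1.2 V2 (Pi i.2)).
pose b (i : nat * nat * H) := iter i.1.1 V1' (iter i.1.2 V2' (Pi' i.2)).
have setE (X : hilbertType R) (S1 S2 : X -> X) (p : H -> X) :
    [set x | exists n1 n2 h, x = iter n1 S1 (iter n2 S2 (p h))] =
    range (fun i : nat * nat * H => iter i.1.1 S1 (iter i.1.2 S2 (p i.2))).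
  apply/seteqP; split=> [_ [n1 [n2 [h ->]]]|_ [[[n1 n2] h] _ <-]].
    by exists (n1, n2, h).
  by exists n1, n2, h.
have atot : clspan (range a) = setT by rewrite -setE; exact: hL.2.
have btot : clspan (range b) = setT by rewrite -setE.
have [|tau itau tauE] := gram_isometry (b := b) atot.
  move=> [[n1 n2] h] [[p1 p2] k]; rewrite /a /b /=.
  (* Any common bound of the four exponents would do. *)
  pose m := (n1 + n2 + (p1 + p2))%N.
  have n1m : (n1 <= m)%N by rewrite /m -addnA leq_addr.
  have n2m : (n2 <= m)%N by rewrite /m addnAC leq_addl.
  have p1m : (p1 <= m)%N by rewrite /m addnCA leq_addr.
  have p2m : (p2 <= m)%N by rewrite /m addnA leq_addl.
  rewrite (lift_gram _ _ n1m n2m p1m p2m) !iter_V1 !iter_V2 !fourier_Pi.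
  by rewrite (model_gram hWD hW _ _ _ _ _ n1m n2m p1m p2m).
exists tau; split.
- split=> //; apply: (isometric_total_surj itau btot) => _ [i _ <-].
  by exists (a i).
- by move=> h; exact: (tauE (0%N, 0%N, h)).
- apply: (total_eq atot) => [||_ [[[n1 n2] h] _ <-]].
  + exact: bounded_comp (isometric_bounded itau) (isometric_bounded hV1).
  + exact: bounded_comp (isometric_bounded iV1) (isometric_bounded itau).
  + by rewrite tauE; exact: (tauE (n1.+1, n2, h)).
- apply: (total_eq atot) => [||_ [[[n1 n2] h] _ <-]].
  + exact: bounded_comp (isometric_bounded itau) (isometric_bounded hV2).
  + exact: bounded_comp (isometric_bounded iV2) (isometric_bounded itau).
  + have -> : V2 (a (n1, n2, h)) = a (n1, n2.+1, h).
      by rewrite /a /= (iter_commute _ _ hV12).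
    by rewrite !tauE /b /= (iter_commute _ _ V12).
Qed.

End Embedding.
End Converse.

Theorem theorem4p2p6 (R : realType) (H : hilbertType R) (T1 T2 : H -> H)
    (hT1 : contractive T1) (hT2 : contractive T2)
    (hT12 : forall h, T1 (T2 h) = T2 (T1 h))
    (* D_{T^*} and Q_{T^*} for T = T1 T2 *)
    (D Q : {linear H -> H})
    (hD : defect_star (T1 \o T2) D) (hQ : asymptotic_root (T1 \o T2) Q)
    (* the space of W_D, which contains the closure of Ran Q_{T^*} via iota *)
    (QT : hilbertType R) (iota : csub (clran Q) -> QT) (WD W1 W2 : QT -> QT)
    (hWD : canonical_unitary (T1 \o T2) iota WD)
    (hW : flat_pair T1 T2 iota WD W1 W2) :
  (forall (F : hilbertType R) (Lam : csub (clran D) -> F) (P U : F -> F),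
     type_I_ando_tuple T1 T2 Lam P U -> douglas_minimal Lam P U ->
     minimal_ando_lift T1 T2
       (model_Pi T1 T2 Lam iota) (model_V1 P U W1) (model_V2 P U W2))
  /\
  (forall (K : hilbertType R) (Pi : H -> K) (V1 V2 : K -> K),
     minimal_ando_lift T1 T2 Pi V1 V2 ->
     exists (F : hilbertType R) (Lam : csub (clran D) -> F) (P U : F -> F),
       [/\ type_I_ando_tuple T1 T2 Lam P U, douglas_minimal Lam P U
         & lift_unitarily_equivalent Pi V1 V2
             (model_Pi T1 T2 Lam iota) (model_V1 P U W1) (model_V2 P U W2)]).
Proof.
split=> [F Lam P U hA hM|K Pi V1 V2 hL].
  exact: (model_minimal hT1 hT2 hT12 hD hQ hWD hW hA hM).
have [Lam hLam LamE] := wandering_embedding hT1 hT2 hD hL.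
exists _, Lam; do 2 eexists; split.
- exact: (wandering_tuple hT1 hT2 hLam LamE).
- exact: (wandering_douglas_minimal hT1 hT2 hD hLam LamE).
- exact: (lift_equivalent_model hT1 hT2 hT12 hD hQ hWD hW hLam LamE).
Qed.
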